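(* Let $n\ge 1$. For $0\le k\le n$ let $\omega_k=(\underbrace{1,\ldots,1}_{k},\underbrace{0,\ldots,0}_{n-k})\in\mathbb{Z}^n$ (so $\omega_1,\dots,\omega_n$ are the fundamental weights of type $C_n$ and $\omega_0=0$). Let $0\le a,b\le n$. Then the two-variable Kostka--Foulkes polynomial $K^{C_n}_{\omega_a,\omega_b}(t,u)$ is zero unless $a\ge b$ and $a\equiv b \bmod 2$. If $a\ge b$ and $a\equiv b\bmod 2$, then $$K^{C_n}_{\omega_{a},\omega_b}(t,u)=t^{\frac{a-b}{2}}\,\frac{t^{n+1-a}-1}{t^{n+1-b}-1}\sum_{i=0}^{\frac{a-b}{2}}(-u)^i\left(t^{i^2-2i}\begin{bmatrix}n-b+1\\ 2i,\ \frac{a-b}{2}-i,\ n+1-\frac{a+b}{2}-i\end{bmatrix}_t(t;t^2)_i\right).$$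
   Context: Type $C_n$ setup: $\Lambda_n=\mathbb{Z}^n$ with standard basis $e_1,\dots,e_n$; $W_n=S_n\ltimes\{\pm1\}^n$ is the Weyl group acting by signed permutations, with sign character $w\mapsto(-1)^w$ (the determinant). The set $R_n^+$ of positive roots consists of the short roots $e_i-e_j,\ e_i+e_j$ ($1\le i<j\le n$) and the long roots $2e_i$ ($1\le i\le n$). $\rho_n=\frac12\sum_{\alpha\in R_n^+}\alpha=(n,n-1,\dots,1)$. Dominant weights: $\Lambda_n^+=\{\lambda\in\mathbb{Z}^n:\lambda_1\ge\cdots\ge\lambda_n\ge0\}$. Put $t_\alpha=t$ if $\alpha$ is short and $t_\alpha=u$ if $\alpha$ is long. The partition function $\mathcal{P}_n(\mu,t,u)\in\mathbb{Z}[t,u]$, $\mu\in\Lambda_n$, is defined by $\prod_{\alpha\in R_n^+}(1-t_\alpha e^\alpha)^{-1}=\sum_{\mu\in\Lambda_n}\mathcal{P}_n(\mu,t,u)e^\mu$. For $\lambda,\mu\in\Lambda_n^+$, the two-variable Kostka--Foulkes polynomial is $$K^{C_n}_{\lambda,\mu}(t,u)=\sum_{w\in W_n}(-1)^w\,\mathcal{P}_n\big(w(\lambda+\rho_n)-(\mu+\rho_n),t,u\big).$$ $t$-analogues: $[m]_t=\frac{1-t^m}{1-t}$, $[m]_t!=\prod_{i=1}^m[i]_t$; the $t$-multinomial is $\begin{bmatrix}m\\ m_1,m_2,m_3\end{bmatrix}_t=\frac{[m]_t!}{[m_1]_t!\,[m_2]_t!\,[m_3]_t!}$ for $m_1+m_2+m_3=m$,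 $m_j\ge0$; $(x;t)_m=\prod_{i=0}^{m-1}(1-xt^i)$, so $(t;t^2)_i=\prod_{j=0}^{i-1}(1-t^{2j+1})$. *)

(* Defs.v *)
From HB Require Import structures.
From mathcomp Require Import all_boot all_order all_fingroup all_algebra.

Set Implicit Arguments.
Unset Strict Implicit.
Unset Printing Implicit Defensive.

Import Order.TTheory GRing.Theory Num.Theory.
Local Open Scope ring_scope.

(* Z[t,u] is encoded as Z[t][u]: [tvar] is the inner variable and [uvar] the
   outer one. *)
Definition Ztu : idomainType := {poly {poly int}}.
Definition tvar : Ztu := 'X%:P.
Definition uvar : Ztu := 'X.

Definition weight (n : nat) := 'rV[int]_n.

(* e_{i+1}, as ordinals start at 0 *)
Definition eps (n : nat) (i : 'I_n) : weight n := delta_mx 0 i.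

Definition short_pos_roots (n : nat) : seq (weight n) :=
  [seq eps p.1 - eps p.2 | p in [pred p : 'I_n * 'I_n | (p.1 < p.2)%N]] ++
  [seq eps p.1 + eps p.2 | p in [pred p : 'I_n * 'I_n | (p.1 < p.2)%N]].

Definition long_pos_roots (n : nat) : seq (weight n) :=
  [seq eps i *+ 2 | i : 'I_n].

Definition pos_roots (n : nat) : seq (weight n) :=
  short_pos_roots n ++ long_pos_roots n.

(* The set R_n^+, as a finite type. *)
Notation pos_root n := (seq_sub (pos_roots n)).

Definition root_var (n : nat) (alpha : weight n) : Ztu :=
  if alpha \in long_pos_roots n then uvar else tvar.

Definition rho (n : nat) : weight n := \row_(i < n) (n - i)%:Z.

(* The pairing of mu with rho; it is at least 1 on every positive root. *)
Definition height (n : nat) (mu : weight n) : int :=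
  \sum_(i < n) mu 0 i * rho n 0 i.

(* The coefficient of e^mu in the product over alpha in R_n^+ of the geometric
   series \sum_m t_alpha^m e^(m alpha): a sum over the families of
   multiplicities m with \sum_alpha m_alpha alpha = mu.  Every such family
   satisfies m_alpha <= height mu ([multiplicity_le_height]), so the bound on
   the multiplicities, which only makes the index type finite, loses no term.
   [partition_fun_generating] checks the defining generating identity. *)
Definition partition_fun (n : nat) (mu : weight n) : Ztu :=
  \sum_(m : {ffun pos_root n -> 'I_`|height mu|.+1} |
        \sum_alpha ssval alpha *+ m alpha == mu)
     \prod_alpha root_var (ssval alpha) ^+ m alpha.

(* The pair (s, d) in S_n x {+-1}^n acts on row vectors by right
   multiplication: e_i is sent to (-1)^(d i) e_(s i). *)
Definition weyl (n : nat) : finType := ('S_n * {ffun 'I_n -> bool})%type.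

Definition weyl_mx (n : nat) (w : weyl n) : 'M[int]_n :=
  \matrix_(i, j) (if w.1 i == j then (-1) ^+ w.2 i else 0).

Definition weyl_act (n : nat) (w : weyl n) (mu : weight n) : weight n :=
  mu *m weyl_mx w.

Definition weyl_sign (n : nat) (w : weyl n) : int := \det (weyl_mx w).

Definition kostka_foulkes (n : nat) (la mu : weight n) : Ztu :=
  \sum_(w : weyl n)
     (weyl_sign w)%:~R *
     partition_fun (weyl_act w (la + rho n) - (mu + rho n)).

Definition omega (n k : nat) : weight n := \row_(i < n) (i < k)%N%:Z.

Definition t_int (F : fieldType) (t : F) (m : nat) : F :=
  (1 - t ^+ m) / (1 - t).

Definition t_fact (F : fieldType) (t : F) (m : nat) : F :=
  \prod_(1 <= i < m.+1) t_int t i.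

(* To be used only with m = m1 + m2 + m3. *)
Definition t_multinomial (F : fieldType) (t : F) (m m1 m2 m3 : nat) : F :=
  t_fact t m / (t_fact t m1 * t_fact t m2 * t_fact t m3).

Definition t_pochhammer (F : fieldType) (x t : F) (m : nat) : F :=
  \prod_(0 <= i < m) (1 - x * t ^+ i).

Lemma weyl_actE (n : nat) (w : weyl n) (mu : weight n) (i : 'I_n) :
  weyl_act w mu 0 (w.1 i) = (-1) ^+ w.2 i * mu 0 i.
Proof.
rewrite /weyl_act mxE (bigD1 i) //= mxE eqxx mulrC big1 ?addr0 // => j ji.
by rewrite mxE (inj_eq perm_inj) (negPf ji) mulr0.
Qed.

Lemma height_is_additive (n : nat) : zmod_morphism (@height n).
Proof.
move=> x y; rewrite /height -sumrB; apply: eq_bigr => i _.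
by rewrite !mxE mulrBl.
Qed.

HB.instance Definition _ (n : nat) :=
  GRing.isZmodMorphism.Build (weight n) int (@height n) (@height_is_additive n).

Lemma height_eps (n : nat) (i : 'I_n) : height (eps i) = (n - i)%:Z.
Proof.
rewrite /height (bigD1 i) //= !mxE !eqxx mul1r big1 ?addr0 // => j ji.
by rewrite !mxE (negPf ji) mul0r.
Qed.

Lemma height_pos_root (n : nat) (alpha : weight n) :
  alpha \in pos_roots n -> 1 <= height alpha.
Proof.
rewrite !mem_cat => /orP[/orP[]|] /imageP[].
- case=> i j /= ij ->; rewrite raddfB /= !height_eps.
  by rewrite lerBrDr -PoszD lez_nat add1n ltn_sub2l.
- case=> i j /= ij ->; rewrite raddfD /= !height_eps.
  by rewrite -PoszD lez_nat addn_gt0 subn_gt0 ltn_ord.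
- move=> i _ ->; rewrite raddfMn /= height_eps.
  by rewrite mulr2n -PoszD lez_nat addn_gt0 subn_gt0 ltn_ord.
Qed.

Lemma multiplicity_le_height (n : nat) (m : pos_root n -> nat) (mu : weight n)
    (alpha : pos_root n) :
  \sum_beta ssval beta *+ m beta = mu -> (m alpha)%:Z <= height mu.
Proof.
have le_m beta : (m beta)%:Z <= height (ssval beta *+ m beta).
  rewrite raddfMn /= -[(m beta)%:Z]natz lerMn2r.
  by rewrite height_pos_root ?orbT ?ssvalP.
move=> <-; rewrite raddf_sum /= (bigD1 alpha) //= -[leLHS]addr0.
by apply: lerD => //; apply: sumr_ge0 => beta _; apply: le_trans (le_m beta).
Qed.

(* Multiplication of the formal series \sum_mu f mu e^mu by
   1 - t_alpha e^alpha. *)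
Definition mul_factor (n : nat) (alpha : weight n) (f : weight n -> Ztu) :
    weight n -> Ztu :=
  fun mu => f mu - root_var alpha * f (mu - alpha).

Definition partition_fun_bounded (n N : nat) (A : {set pos_root n})
    (mu : weight n) : Ztu :=
  \sum_(m : {ffun pos_root n -> 'I_N.+1} |
        [forall alpha, (alpha \in A) || (m alpha == 0 :> nat)] &&
        (\sum_alpha ssval alpha *+ m alpha == mu))
     \prod_alpha root_var (ssval alpha) ^+ m alpha.

Lemma partition_fun_bounded_eq (n M N : nat) (A : {set pos_root n})
    (mu : weight n) :
  height mu <= M%:Z -> height mu <= N%:Z ->
  partition_fun_bounded M A mu = partition_fun_bounded N A mu.
Proof.
wlog le_MN : M N / (M <= N)%N => [hw hM hN|hM _].
  by case/orP: (leq_total M N) => le; [|symmetry]; apply: hw.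
have le_MN1 : (M.+1 <= N.+1)%N by [].
pose h (m : {ffun pos_root n -> 'I_N.+1}) : {ffun pos_root n -> 'I_M.+1} :=
  [ffun alpha => inord (m alpha)].
pose g (m : {ffun pos_root n -> 'I_M.+1}) : {ffun pos_root n -> 'I_N.+1} :=
  [ffun alpha => widen_ord le_MN1 (m alpha)].
rewrite /partition_fun_bounded [RHS](reindex_onto g h) /=; last first.
  move=> m /andP[_ /eqP eq_mu]; apply/ffunP => alpha; rewrite !ffunE.
  apply: val_inj; rewrite /= inordK // ltnS -lez_nat.
  exact: le_trans (multiplicity_le_height alpha eq_mu) hM.
have gE m alpha : (g m alpha = m alpha :> nat) by rewrite ffunE.
apply: eq_big => m; last by move=> _; apply: eq_bigr => alpha _; rewrite gE.
have -> : h (g m) == m.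
  by apply/eqP/ffunP => alpha; rewrite !ffunE; apply: val_inj; rewrite /= inordK.
rewrite andbT; congr (_ && _).
  by apply: eq_forallb => alpha; rewrite gE.
by congr (_ == _); apply: eq_bigr => alpha _; rewrite gE.
Qed.

Lemma mul_factor_bounded (n N : nat) (A : {set pos_root n})
    (alpha : pos_root n) (mu : weight n) :
  alpha \in A -> height mu <= N%:Z ->
  partition_fun_bounded N A mu
    - root_var (ssval alpha) * partition_fun_bounded N A (mu - ssval alpha)
  = partition_fun_bounded N (A :\ alpha) mu.
Proof.
move=> Aalpha hN.
pose R := {ffun pos_root n -> 'I_N.+1}.
rewrite {1}/partition_fun_bounded (bigID (fun m : R => m alpha == 0 :> nat)) /=.
set S0 := (X in X + _ - _); set S1 := (X in _ + X - _).
suff [-> ->] : S0 = partition_fun_bounded N (A :\ alpha) mu /\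
  S1 = root_var (ssval alpha) * partition_fun_bounded N A (mu - ssval alpha).
  by rewrite addrK.
rewrite {}/S0 {}/S1; split.
  apply: eq_bigl => m; rewrite andbAC; congr (_ && _).
  apply/andP/forallP => [[/forallP mA m0] beta|mA].
    by rewrite !inE; case: (eqVneq beta alpha) => [->|_ //=]; rewrite m0 orbT.
  split; last by have := mA alpha; rewrite !inE eqxx.
  apply/forallP => beta; have := mA beta; rewrite !inE.
  by case/orP => [/andP[_ ->]|->]; rewrite ?orbT.
pose up (m : R) : R := [ffun beta => inord (m beta + (beta == alpha))].
pose dn (m : R) : R := [ffun beta => inord (m beta - (beta == alpha))].
have dnE m beta : dn m beta = (m beta - (beta == alpha))%N :> nat.
  by rewrite ffunE inordK // ltnS (leq_trans (leq_subr _ _)) // -ltnS.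
rewrite (reindex_onto up dn) /=; last first.
  move=> m /andP[_ m0]; apply/ffunP => beta; apply: val_inj.
  rewrite ffunE /= dnE; case: eqP => [->|_]; last by rewrite subn0 addn0 inord_val.
  by rewrite subnK ?lt0n // inord_val.
have ltN (m : R) : \sum_beta ssval beta *+ m beta = mu - ssval alpha ->
    forall beta, (m beta < N)%N.
  move=> eq_mu beta; rewrite -ltz_nat.
  apply: le_lt_trans (multiplicity_le_height beta eq_mu) _.
  rewrite raddfB /=; apply: lt_le_trans hN.
  by rewrite ltrBlDr ltrDl (lt_le_trans _ (height_pos_root (ssvalP alpha))).
have upE (m : R) : (forall beta, (m beta < N)%N) ->
    forall beta, up m beta = (m beta + (beta == alpha))%N :> nat.
  move=> lt_m beta; rewrite ffunE inordK // ltnS.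
  by case: eqP => _; rewrite ?addn1 ?addn0 // ltnW.
have sum_up (m : R) : \sum_beta ssval beta *+ (m beta + (beta == alpha)) =
    \sum_beta ssval beta *+ m beta + ssval alpha.
  under eq_bigr do rewrite mulrnDr.
  rewrite big_split /=; congr (_ + _).
  by rewrite (bigD1 alpha) //= eqxx big1 ?addr0 // => beta /negPf ->.
have prod_up (m : R) :
    \prod_beta root_var (ssval beta) ^+ (m beta + (beta == alpha)) =
    root_var (ssval alpha) * \prod_beta root_var (ssval beta) ^+ m beta.
  under eq_bigr do rewrite exprD.
  rewrite big_split /= mulrC; congr (_ * _).
  by rewrite (bigD1 alpha) //= eqxx big1 ?mulr1 // => beta /negPf ->.
rewrite /partition_fun_bounded mulr_sumr.
have eqP1 (m : R) :
  [&& [forall beta, (beta \in A) || (up m beta == 0 :> nat)] &&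
      (\sum_beta ssval beta *+ up m beta == mu),
      up m alpha != 0 :> nat & dn (up m) == m] =
  [forall beta, (beta \in A) || (m beta == 0 :> nat)] &&
  (\sum_beta ssval beta *+ m beta == mu - ssval alpha).
  apply/idP/idP => [/and3P[/andP[/forallP mA /eqP eq_mu] m0 /eqP dnK]|].
    have upE' beta : up m beta = (m beta + (beta == alpha))%N :> nat.
      rewrite -{2}dnK dnE; case: eqP => [->|_]; last by rewrite subn0 addn0.
      by rewrite subnK // lt0n.
    apply/andP; split.
      apply/forallP => beta; have := mA beta; rewrite upE'.
      by case: (beta \in A) => //=; rewrite addn_eq0 => /andP[].
    by rewrite -eq_mu -subr_eq0; under [X in _ - (X - _)]eq_bigr do rewrite upE';
       rewrite sum_up addrK subrr.
  case/andP=> /forallP mA /eqP eq_mu; have lt_m := ltN m eq_mu.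
  apply/and3P; split.
  - apply/andP; split.
      apply/forallP => beta; have := mA beta; rewrite upE //.
      by case: (eqVneq beta alpha) => [->|_]; rewrite ?Aalpha // addn0.
    under eq_bigr do rewrite upE //.
    by rewrite sum_up eq_mu subrK.
  - by rewrite upE // eqxx addn1.
  - by apply/eqP/ffunP => beta; apply: val_inj; rewrite /= dnE upE // addnK.
apply: eq_big => [m|m]; first by rewrite -eqP1 !andbA.
rewrite -andbA eqP1 => /andP[_ /eqP /ltN lt_m].
by under eq_bigr do rewrite upE //; rewrite prod_up.
Qed.

(* In the ring of formal series,
   (\prod_(alpha in R_n^+) (1 - t_alpha e^alpha)) *
   (\sum_mu (partition_fun mu) e^mu) = 1. *)
Lemma partition_fun_generating (n : nat) (mu : weight n) :
  foldr (@mul_factor n) (@partition_fun n) [seq ssval alpha | alpha : pos_root n]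
    mu = (mu == 0)%:R.
Proof.
have fold_bounded (s : seq (pos_root n)) : uniq s -> forall nu N,
    height nu <= N%:Z ->
    foldr (@mul_factor n) (@partition_fun n) (map (@ssval _ _) s) nu =
    partition_fun_bounded N (~: [set x in s]) nu.
  elim: s => [_ nu N hN|alpha s IHs /=/andP[s'alpha /IHs{}IHs] nu N hN].
    rewrite /= (@partition_fun_bounded_eq n N `|height nu|%N) ?abszE ?ler_norm //.
    apply: eq_bigl => m; rewrite [X in X && _](_ : _ = true) //.
    by apply/forallP => alpha; rewrite !inE.
  rewrite /mul_factor (IHs _ N) // (IHs _ N); last first.
    rewrite raddfB /= (le_trans _ hN) // gerBl.
    by rewrite (le_trans _ (height_pos_root (ssvalP alpha))).
  rewrite mul_factor_bounded ?inE //; congr partition_fun_bounded.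
  by apply/setP => beta; rewrite !inE negb_or.
rewrite (fold_bounded _ (enum_uniq _) _ `|height mu|%N) ?abszE ?ler_norm //.
rewrite /partition_fun_bounded.
pose m0 : {ffun pos_root n -> 'I_`|height mu|.+1} := [ffun=> ord0].
have sum_m0 : \sum_alpha ssval alpha *+ m0 alpha = 0.
  by apply: big1 => alpha _; rewrite ffunE.
under eq_bigl => m.
  have -> : [forall alpha, (alpha \in ~: [set x in enum {: pos_root n}]) ||
                           (m alpha == 0 :> nat)] = (m == m0).
    apply/forallP/eqP => [m_0|-> alpha]; last by rewrite ffunE eqxx orbT.
    apply/ffunP => alpha; apply: val_inj; rewrite ffunE /=; apply/eqP.
    by have := m_0 alpha; rewrite !inE mem_enum.
  over.
rewrite big_mkcondr big_pred1_eq /= sum_m0 eq_sym; case: eqP => // _.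
by apply: big1 => alpha _; rewrite ffunE.
Qed.

(* Main.v *)
(* Write E_n(f) = CT(f prod_(alpha > 0) (1 - e^(-alpha)) / (1 - t_alpha e^(-alpha))),
   so that K_{lambda, 0} = E_n(chi_lambda).  Expanding along the first
   coordinate gives K_{omega_a, omega_b} = K_{omega_(a-1), omega_(b-1)} one rank
   lower, which reduces to b = 0, and expresses K_{omega_a, 0} in rank n + 2
   through E_(n+1)(e_1 chi_lambda), where e_1 = sum_i (x_i + 1/x_i).  For each
   simple root alpha the kernel without the factor of alpha is
   s_alpha-invariant; hence, against antisymmetric functions, the insertions of
   the x_i^(+-1) are all multiples, by powers of t and u, of a single one, which
   collapses to rank n.  With K_n(a) = K_{omega_a, 0} in rank n this gives
   K_(n+2)(a+2) = K_(n+1)(a+2) + K_(n+1)(a)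
                  - (1 - t^(n+1)) (1 + u t^n) K_n(a),
   a recurrence which the closed formula satisfies coefficientwise in u. *)
From HB Require Import structures.
Require Import Defs.
From mathcomp Require Import all_boot all_order all_fingroup all_algebra.
From mathcomp Require Import ring zify.
Import Order.TTheory GRing.Theory Num.Theory.
Local Open Scope ring_scope.

Set Implicit Arguments.
Unset Strict Implicit.
Unset Printing Implicit Defensive.

(** * Formal series supported in a half-space *)

Section MulFactors.
Variable n : nat.
Implicit Types (f g : weight n -> Ztu) (s : seq (weight n)) (B : int).
Implicit Types (h : {additive weight n -> int}).

Definition mul_factors s f := foldr (@mul_factor n) f s.

Definition support_ge h B f := forall mu, h mu < B -> f mu = 0.

Lemma eq_mul_factor alpha f g :
  f =1 g -> mul_factor alpha f =1 mul_factor alpha g.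
Proof. by move=> fg mu; rewrite /mul_factor !fg. Qed.

Lemma mul_factorC alpha beta f :
  mul_factor alpha (mul_factor beta f) =1 mul_factor beta (mul_factor alpha f).
Proof. by move=> mu; rewrite /mul_factor [mu - beta - alpha]addrAC; ring. Qed.

Lemma mul_factors_factor s alpha f :
  mul_factors s (mul_factor alpha f) =1 mul_factor alpha (mul_factors s f).
Proof.
elim: s => //= beta s IHs mu; rewrite mul_factorC.
exact: eq_mul_factor.
Qed.

Lemma mul_factors_rem s alpha f : alpha \in s ->
  mul_factors s f =1 mul_factors (rem alpha s) (mul_factor alpha f).
Proof.
elim: s => //= beta s IHs; rewrite inE; case: (eqVneq alpha beta) => /=.
  by move=> -> _ mu; rewrite mul_factors_factor.
move=> ne /IHs{}IHs mu /=.
exact: eq_mul_factor.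
Qed.

Lemma perm_mul_factors s1 s2 f :
  perm_eq s1 s2 -> mul_factors s1 f =1 mul_factors s2 f.
Proof.
elim: s1 s2 f => [|alpha s1 IHs] s2 f; first by rewrite perm_sym => /perm_nilP ->.
move=> eq_s mu; have in_s : alpha \in s2 by rewrite -(perm_mem eq_s) mem_head.
have eq_rem : perm_eq s1 (rem alpha s2).
  by rewrite -(perm_cons alpha) (perm_trans eq_s) // perm_to_rem.
by rewrite (mul_factors_rem f in_s) -(IHs _ _ eq_rem) mul_factors_factor.
Qed.

Lemma support_mul_factor h B alpha f :
  0 <= h alpha -> support_ge h B f -> support_ge h B (mul_factor alpha f).
Proof.
move=> h_ge0 supp mu lt_mu; rewrite /mul_factor !supp ?mulr0 ?subr0 //.
by rewrite raddfB (le_lt_trans _ lt_mu) // gerBl.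
Qed.

Lemma support_mul_factors h B s f :
  {in s, forall alpha, 0 <= h alpha} -> support_ge h B f ->
  support_ge h B (mul_factors s f).
Proof.
elim: s => //= alpha s IHs h_ge0 supp; apply: support_mul_factor.
  exact/h_ge0/mem_head.
by apply: IHs => // beta ins; apply: h_ge0; rewrite inE ins orbT.
Qed.

(** The coefficient at [mu] is recovered from the product and the coefficient at [mu - alpha], where
    [h] is smaller. Both series vanish where [h] is below [B], so induction on the distance to [B]
    applies. *)
Lemma mul_factor_inj h B alpha f g :
  0 < h alpha -> support_ge h B f -> support_ge h B g ->
  mul_factor alpha f =1 mul_factor alpha g -> f =1 g.
Proof.
move=> h_gt0 suppf suppg eq_fg.
suff low k mu : h mu < B + k%:Z -> f mu = g mu.
  move=> mu; apply: (low `|h mu - B|.+1) => //.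
  by have := h_gt0; lia.
elim: k mu => [|k IHk] mu lt_mu.
  by rewrite addr0 in lt_mu; rewrite suppf ?suppg.
have := eq_fg mu; rewrite /mul_factor (IHk (mu - alpha)); first exact: addIr.
by rewrite raddfB; move: (h alpha) (h mu) h_gt0 lt_mu => x y; lia.
Qed.

Lemma mul_factors_inj h B s f g :
  {in s, forall alpha, 0 < h alpha} -> support_ge h B f -> support_ge h B g ->
  mul_factors s f =1 mul_factors s g -> f =1 g.
Proof.
elim: s => //= alpha s IHs h_gt0 suppf suppg eq_fg.
have h_gt0s : {in s, forall beta, 0 < h beta}.
  by move=> beta ins; apply: h_gt0; rewrite inE ins orbT.
have h_ge0s : {in s, forall beta, 0 <= h beta} by move=> beta /h_gt0s/ltW.
apply: IHs => //; apply: (@mul_factor_inj h B alpha) => //.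
- by apply: h_gt0; rewrite mem_head.
- exact: support_mul_factors.
- exact: support_mul_factors.
Qed.

(** Multiplication by the factors commutes with scalars and with translations of the weight. *)
Lemma mul_factors_translates s f (c : Ztu) (ks : seq (weight n)) mu :
  mul_factors s (fun nu => c * \sum_(k <- ks) f (nu - k)) mu =
  c * \sum_(k <- ks) mul_factors s f (mu - k).
Proof.
elim: s mu => //= alpha s IHs mu; rewrite {1}/mul_factor !IHs.
rewrite mulrCA -mulrBr mulr_sumr -sumrB; congr (_ * _).
by apply: eq_bigr => k _; rewrite /mul_factor [mu - alpha - k]addrAC.
Qed.

End MulFactors.

(** * Positive roots *)

Section Roots.
Variable n : nat.
Implicit Types (i j : 'I_n) (alpha : weight n).

Variant pos_root_spec : weight n -> Prop :=
| PosRootDiff i j of (i < j)%N : pos_root_spec (eps i - eps j)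
| PosRootSum i j of (i < j)%N : pos_root_spec (eps i + eps j)
| PosRootLong i : pos_root_spec (eps i *+ 2).

Lemma pos_rootP alpha : alpha \in pos_roots n -> pos_root_spec alpha.
Proof.
rewrite !mem_cat => /orP[/orP[]|] /imageP[].
- by case=> i j /= ij ->; apply: PosRootDiff.
- by case=> i j /= ij ->; apply: PosRootSum.
- by move=> i _ ->; apply: PosRootLong.
Qed.

Lemma pos_root_diff i j : (i < j)%N -> eps i - eps j \in pos_roots n.
Proof.
move=> ij; rewrite !mem_cat; apply/orP; left; apply/orP; left.
by apply/imageP; exists (i, j).
Qed.

Lemma pos_root_sum i j : i != j -> eps i + eps j \in pos_roots n.
Proof.
wlog ij : i j / (i < j)%N => [hw ne|_].
  by case: (ltngtP i j) (ne) => [/hw->|/hw|/val_inj->]; rewrite ?eqxx // addrC eq_sym; apply.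
rewrite !mem_cat; apply/orP; left; apply/orP; right.
by apply/imageP; exists (i, j).
Qed.

Lemma pos_root_long i : eps i *+ 2 \in pos_roots n.
Proof. by rewrite !mem_cat; apply/orP; right; apply/imageP; exists i. Qed.

Lemma epsE i j : eps i 0 j = (i == j)%:R.
Proof. by rewrite mxE eqxx eq_sym. Qed.

Lemma root_var_long i : root_var (eps i *+ 2) = uvar.
Proof. by rewrite /root_var image_f. Qed.

(** All coordinates of a long root are even. *)
Lemma root_var_odd i alpha : alpha 0 i = 1 -> root_var alpha = tvar.
Proof.
move=> a1; rewrite /root_var; case: imageP => // -[j _ aE].
by move: a1; rewrite aE mulmxnE epsE; case: eqP; lia.
Qed.

Lemma root_var_diff i j : i != j -> root_var (eps i - eps j) = tvar.
Proof.
by move=> /negPf ij; apply: (@root_var_odd i); rewrite !mxE !eqxx ij subr0.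
Qed.

Lemma root_var_sum i j : i != j -> root_var (eps i + eps j) = tvar.
Proof.
by move=> /negPf ij; apply: (@root_var_odd i); rewrite !mxE !eqxx ij addr0.
Qed.

Definition root_enum := [seq ssval alpha | alpha : pos_root n].

Lemma root_enum_uniq : uniq root_enum.
Proof. by rewrite map_inj_uniq ?enum_uniq //; apply: val_inj. Qed.

Lemma mem_root_enum : root_enum =i pos_roots n.
Proof.
move=> alpha; apply/imageP/idP => [[beta _ ->]|ina]; first exact: ssvalP.
by exists (SeqSub ina).
Qed.

Lemma support_partition_fun (h : {additive weight n -> int}) :
  {in pos_roots n, forall alpha, 0 <= h alpha} ->
  support_ge h 0 (@partition_fun n).
Proof.
move=> h_ge0 mu lt_mu; apply: big_pred0 => m; apply/eqP => eq_mu.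
move: lt_mu; rewrite -eq_mu ltNge raddf_sum; apply/negP/negPn.
by apply: sumr_ge0 => beta _; rewrite raddfMn mulrn_wge0 // h_ge0 ?ssvalP.
Qed.

Lemma support_partition_fun_height : support_ge (@height n) 0 (@partition_fun n).
Proof.
by apply: support_partition_fun => alpha /height_pos_root; apply: le_trans.
Qed.

(** Multiplication by the factors is injective on series supported in [h >= 0], so the generating
    identity has a single solution there. *)
Lemma partition_fun_unique (h : {additive weight n -> int}) f :
  {in pos_roots n, forall alpha, 0 < h alpha} -> support_ge h 0 f ->
  (forall mu, mul_factors root_enum f mu = (mu == 0)%:R) ->
  f =1 @partition_fun n.
Proof.
move=> h_gt0 supp eq_f; apply: (@mul_factors_inj _ h 0 root_enum) => //.
- by move=> alpha; rewrite mem_root_enum; apply: h_gt0.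
- by apply: support_partition_fun => alpha /h_gt0/ltW.
- by move=> mu; rewrite eq_f -partition_fun_generating.
Qed.

End Roots.

(** * Symmetry of the partition function under a reflection *)

Section Reflection.
Variables (n : nat) (r : {additive weight n -> weight n}) (alpha : weight n).
Hypothesis rK : involutive r.
Hypothesis alpha_root : alpha \in pos_roots n.
Hypothesis r_alpha : r alpha = - alpha.
Hypothesis r_root : forall beta, beta \in pos_roots n -> beta != alpha ->
  r beta \in pos_roots n.
Hypothesis r_var : forall beta, beta \in pos_roots n -> beta != alpha ->
  root_var (r beta) = root_var beta.

(** [P1] is the inverse of the product of the factors over [s], that is, over all positive roots but
    [alpha]. *)
Let P1 := mul_factor alpha (@partition_fun n).
Let s := rem alpha (root_enum n).

Let mem_s beta : (beta \in s) = (beta != alpha) && (beta \in pos_roots n).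
Proof. by rewrite mem_rem_uniq ?root_enum_uniq // !inE mem_root_enum. Qed.

Let height_r_root : {in s, forall beta, r beta \in s}.
Proof.
move=> beta; rewrite !mem_s => /andP[ne inb]; rewrite r_root // andbT.
apply/eqP => rb; have := height_pos_root inb.
rewrite -[beta]rK rb r_alpha raddfN /=.
by have := height_pos_root alpha_root; lia.
Qed.

(** Adding the height and its image under [r] gives an [r]-invariant functional, zero on [alpha] and
    positive on [s]. Hence [P1] and its image under [r] are supported in the same half-space and can
    be compared by [mul_factors_inj]. *)
Let h mu := height mu + height (r mu).

Let h_is_additive : zmod_morphism h.
Proof. by move=> x y; rewrite /h !raddfB opprD addrACA. Qed.

HB.instance Definition _ :=
  GRing.isZmodMorphism.Build (weight n) int h h_is_additive.

Let h_alpha : h alpha = 0.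
Proof. by rewrite /h r_alpha raddfN /= subrr. Qed.

Let h_gt0 : {in s, forall beta, 0 < h beta}.
Proof.
move=> beta ins; have := height_r_root ins; move: ins; rewrite !mem_s.
by move=> /andP[_ /height_pos_root ?] /andP[_ /height_pos_root ?]; rewrite /h; lia.
Qed.

Let map_s : perm_eq (map r s) s.
Proof.
have us : uniq s by rewrite rem_uniq ?root_enum_uniq.
have um : uniq (map r s) by rewrite map_inj_uniq //; apply: inv_inj.
apply: uniq_perm => // beta.
have sub : {subset map r s <= s} by move=> _ /mapP[g /height_r_root ? ->].
by have [] := uniq_min_size um sub; rewrite ?size_map.
Qed.

(* The reflection permutes the positive roots other than [alpha], whose factors
   are the ones left in [P1]. *)
Lemma mul_factor_partition_fun_refl mu : P1 (r mu) = P1 mu.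
Proof.
have suppP1 : support_ge h 0 P1.
  apply: support_mul_factor; first by rewrite /= h_alpha.
  apply: support_partition_fun => beta inb /=.
  have [->|ne] := eqVneq beta alpha; first by rewrite h_alpha.
  by apply/ltW/h_gt0; rewrite mem_s ne.
have P1s nu : mul_factors s P1 nu = (nu == 0)%:R.
  by rewrite -mul_factors_rem ?mem_root_enum // -partition_fun_generating.
apply: (@mul_factors_inj _ h 0 s (fun mu => P1 (r mu)) P1 h_gt0) => //.
  by move=> nu; rewrite /= => lt; apply: suppP1; move: lt; rewrite /= /h rK addrC.
have mapE (l : seq (weight n)) : {subset l <= s} -> forall nu,
    mul_factors l (fun mu => P1 (r mu)) nu = mul_factors (map r l) P1 (r nu).
  elim: l => //= beta l IHl sub nu.
  have subl : {subset l <= s} by move=> x xl; apply: sub; rewrite inE xl orbT.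
  rewrite /mul_factor !IHl // raddfB r_var //.
    by have := sub _ (mem_head _ _); rewrite mem_s => /andP[].
  by have := sub _ (mem_head _ _); rewrite mem_s => /andP[].
move=> nu; rewrite mapE // (perm_mul_factors _ map_s) !P1s.
by rewrite raddf_eq0 //; apply: inv_inj.
Qed.

End Reflection.

(** * Splitting off the first coordinate *)

Section ConsWeight.
Variable n : nat.
Implicit Types (x : int) (mu : weight n).

Definition cons_weight x mu : weight n.+1 :=
  \row_j (if unlift ord0 j is Some k then mu 0 k else x).

Lemma cons_weight0 x mu : cons_weight x mu 0 ord0 = x.
Proof. by rewrite mxE unlift_none. Qed.

Lemma cons_weightS x mu j : cons_weight x mu 0 (lift ord0 j) = mu 0 j.
Proof. by rewrite mxE liftK. Qed.

Lemma cons_weight_ext (mu nu : weight n.+1) : mu 0 ord0 = nu 0 ord0 ->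
  (forall j, mu 0 (lift ord0 j) = nu 0 (lift ord0 j)) -> mu = nu.
Proof.
by move=> e0 eS; apply/rowP => j; case: (unliftP ord0 j) => [k|] ->.
Qed.

Lemma cons_weight_col' x mu : col' ord0 (cons_weight x mu) = mu.
Proof. by apply/rowP => j; rewrite !mxE liftK. Qed.

Lemma cons_weightD x y mu nu :
  cons_weight x mu + cons_weight y nu = cons_weight (x + y) (mu + nu).
Proof.
by apply: cons_weight_ext => [|j]; rewrite mxE ?cons_weight0 ?cons_weightS ?mxE.
Qed.

Lemma cons_weightN x mu : - cons_weight x mu = cons_weight (- x) (- mu).
Proof.
by apply: cons_weight_ext => [|j]; rewrite mxE ?cons_weight0 ?cons_weightS ?mxE.
Qed.

Lemma cons_weightB x y mu nu :
  cons_weight x mu - cons_weight y nu = cons_weight (x - y) (mu - nu).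
Proof. by rewrite cons_weightN cons_weightD. Qed.

Lemma cons_weight00 : cons_weight 0 0 = 0.
Proof.
by apply: cons_weight_ext => [|j]; rewrite ?cons_weight0 ?cons_weightS ?mxE.
Qed.

Lemma cons_weight_inj x : injective (cons_weight x).
Proof. by move=> mu nu eq_mu; rewrite -(cons_weight_col' x mu) eq_mu cons_weight_col'. Qed.

Lemma cons_weight_eq0 x mu : (cons_weight x mu == 0) = (x == 0) && (mu == 0).
Proof.
apply/eqP/andP => [eq0|[/eqP-> /eqP->]]; last exact: cons_weight00.
have x0 : x = 0 by rewrite -(cons_weight0 x mu) eq0 mxE.
rewrite x0 in eq0 *; split=> //; apply/eqP.
by apply: (@cons_weight_inj 0); rewrite cons_weight00.
Qed.

Lemma eps_cons0 : eps ord0 = cons_weight 1 0.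
Proof.
by apply: cons_weight_ext => [|j]; rewrite ?cons_weight0 ?cons_weightS epsE ?mxE.
Qed.

Lemma eps_consS (i : 'I_n) : eps (lift ord0 i) = cons_weight 0 (eps i).
Proof.
by apply: cons_weight_ext => [|j]; rewrite ?cons_weight0 ?cons_weightS !epsE ?(inj_eq lift_inj).
Qed.

Lemma rho_cons : rho n.+1 = cons_weight n.+1%:Z (rho n).
Proof.
apply: cons_weight_ext => [|j]; rewrite ?cons_weight0 ?cons_weightS !mxE ?subn0 //.
Qed.

Lemma omega_consS a : omega n.+1 a.+1 = cons_weight 1 (omega n a).
Proof.
by apply: cons_weight_ext => [|j]; rewrite ?cons_weight0 ?cons_weightS !mxE.
Qed.

Lemma height_cons x mu : height (cons_weight x mu) = x * n.+1%:Z + height mu.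
Proof.
rewrite /height big_ord_recl cons_weight0 rho_cons cons_weight0; congr (_ + _).
by apply: eq_bigr => i _; rewrite !cons_weightS.
Qed.

End ConsWeight.

Lemma omega0 n : omega n 0 = 0.
Proof. by apply/rowP => j; rewrite !mxE. Qed.

(* The short positive roots with nonzero first coordinate are exactly the
   [cons_weight 1 (unit_weight p)]. *)
Definition unit_weight n (p : 'I_n * bool) : weight n := (-1) ^+ p.2 *: eps p.1.

Lemma unit_weightE n (p : 'I_n * bool) :
  unit_weight p = if p.2 then - eps p.1 else eps p.1.
Proof. by rewrite /unit_weight; case: p.2; rewrite ?expr1 ?scaleN1r ?expr0 ?scale1r. Qed.

Lemma unit_weight_inj n : injective (@unit_weight n).
Proof.
move=> [i b] [j c]; rewrite !unit_weightE /= => /rowP/(_ i).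
case: b c => -[]; rewrite !mxE !eqxx /=; case: (eqVneq i j) => [->|] //.
Qed.

Lemma height_unit_weight_ge n (p : 'I_n * bool) :
  - n%:Z <= height (unit_weight p).
Proof. by rewrite unit_weightE; case: p.2; rewrite ?raddfN /= height_eps; lia. Qed.

Section FirstCoordinate.
Variable n : nat.

Definition first_coord (mu : weight n.+1) : int := mu 0 ord0.

Lemma first_coord_is_additive : zmod_morphism first_coord.
Proof. by move=> x y; rewrite /first_coord !mxE. Qed.

HB.instance Definition _ :=
  GRing.isZmodMorphism.Build (weight n.+1) int first_coord first_coord_is_additive.

Lemma first_coord_cons x (mu : weight n) : first_coord (cons_weight x mu) = x.
Proof. exact: cons_weight0. Qed.

Definition cons_roots : seq (weight n.+1) :=
  map (cons_weight 0) (root_enum n).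
Definition first_short_roots : seq (weight n.+1) :=
  [seq cons_weight 1 k | k <- [seq unit_weight p | p : 'I_n * bool]].

Lemma eps_long_cons : eps (@ord0 n) *+ 2 = cons_weight 2 0.
Proof. by rewrite mulr2n eps_cons0 cons_weightD addr0. Qed.

(** The positive roots are sorted by their first coordinate: 2 for one long root, 1 for the short
    roots that involve the first basis vector, 0 for the roots coming from rank [n]. *)
Lemma root_enum_cons :
  perm_eq (root_enum n.+1) (eps ord0 *+ 2 :: first_short_roots ++ cons_roots).
Proof.
apply: uniq_perm => [||alpha]; first exact: root_enum_uniq.
  have u1 : uniq first_short_roots.
    rewrite map_inj_uniq; last exact: cons_weight_inj.
    by rewrite map_inj_uniq -?enumT ?enum_uniq //; apply: unit_weight_inj.
  have u2 : uniq cons_roots.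
    by rewrite map_inj_uniq ?root_enum_uniq //; apply: cons_weight_inj.
  rewrite cons_uniq cat_uniq u1 u2 mem_cat negb_or andbT eps_long_cons -!andbA.
  apply/and4P; split=> //.
  - by apply/mapP => -[k _ /(congr1 first_coord)]; rewrite !first_coord_cons.
  - by apply/mapP => -[k _ /(congr1 first_coord)]; rewrite !first_coord_cons.
  - apply/hasPn => _ /mapP[k _ ->]; apply/mapP => -[l _ /(congr1 first_coord)].
    by rewrite !first_coord_cons.
have short_mem (p : 'I_n * bool) :
    cons_weight 1 (unit_weight p) \in first_short_roots.
  by rewrite map_f // image_f.
have cons_mem beta : beta \in pos_roots n -> cons_weight 0 beta \in cons_roots.
  by move=> inb; rewrite map_f ?mem_root_enum.
have -> : (alpha \in eps ord0 *+ 2 :: first_short_roots ++ cons_roots) =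
    [|| alpha == eps ord0 *+ 2, alpha \in first_short_roots | alpha \in cons_roots].
  by rewrite in_cons mem_cat.
rewrite mem_root_enum; apply/idP/idP.
  move=> /pos_rootP[i j|i j|i].
  - case: (unliftP ord0 i) => [i'|] ->;
      case: (unliftP ord0 j) => [j'|] -> //= ij.
    + by rewrite !eps_consS cons_weightB subrr cons_mem ?orbT // pos_root_diff.
    + rewrite eps_cons0 eps_consS cons_weightB subr0 sub0r.
      by have := short_mem (j', true); rewrite unit_weightE /= => ->; rewrite orbT.
  - case: (unliftP ord0 i) => [i'|] ->;
      case: (unliftP ord0 j) => [j'|] -> //= ij.
    + rewrite !eps_consS cons_weightD addr0 cons_mem ?orbT // pos_root_sum //.
      by apply/eqP => e; rewrite e ltnn in ij.
    + rewrite eps_cons0 eps_consS cons_weightD addr0 add0r.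
      by have := short_mem (j', false); rewrite unit_weightE /= => ->; rewrite orbT.
  - case: (unliftP ord0 i) => [i'|] ->; last by rewrite eqxx.
    rewrite mulr2n eps_consS cons_weightD addr0 -mulr2n cons_mem ?orbT //.
    exact: pos_root_long.
case/or3P => [/eqP->|/mapP[_ /imageP[[j b] _ ->] ->]|/mapP[beta + ->]].
- exact: pos_root_long.
- rewrite unit_weightE /=; case: b.
    have -> : cons_weight 1 (- eps j) = eps ord0 - eps (lift ord0 j).
      by rewrite eps_cons0 eps_consS cons_weightB subr0 sub0r.
    exact: pos_root_diff.
  have -> : cons_weight 1 (eps j) = eps ord0 + eps (lift ord0 j).
    by rewrite eps_cons0 eps_consS cons_weightD addr0 add0r.
  exact: pos_root_sum.
- rewrite mem_root_enum => /pos_rootP[i j ij|i j ij|i].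
  + rewrite -(subrr 0) -cons_weightB -!eps_consS; exact: pos_root_diff.
  + rewrite -(addr0 0) -cons_weightD -!eps_consS; apply: pos_root_sum.
    by rewrite (inj_eq lift_inj); apply/eqP => e; rewrite e ltnn in ij.
  + rewrite mulr2n -(addr0 0) -cons_weightD -!eps_consS -mulr2n.
    exact: pos_root_long.
Qed.

Lemma first_root_ge0 : {in pos_roots n.+1, forall alpha, 0 <= first_coord alpha}.
Proof.
move=> alpha; rewrite -mem_root_enum (perm_mem root_enum_cons) inE mem_cat.
case/or3P => [/eqP->|/mapP[k _ ->]|/mapP[k _ ->]]; rewrite ?eps_long_cons ?first_coord_cons //.
Qed.

Lemma root_var_cons0 (alpha : weight n) : alpha \in pos_roots n ->
  root_var (cons_weight 0 alpha) = root_var alpha.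
Proof.
move=> /pos_rootP[i j ij|i j ij|i].
- have ne : i != j by apply/eqP => e; rewrite e ltnn in ij.
  rewrite -{1}(subrr 0) -cons_weightB -!eps_consS.
  by rewrite !root_var_diff // (inj_eq lift_inj).
- have ne : i != j by apply/eqP => e; rewrite e ltnn in ij.
  rewrite -{1}(addr0 0) -cons_weightD -!eps_consS.
  by rewrite !root_var_sum // (inj_eq lift_inj).
- by rewrite mulr2n -{1}(addr0 0) -cons_weightD -!eps_consS -!mulr2n !root_var_long.
Qed.

Lemma partition_fun_cons_lt0 x (mu : weight n) :
  x < 0 -> partition_fun (cons_weight x mu) = 0.
Proof.
move=> x_lt0; apply: (support_partition_fun first_root_ge0).
by rewrite /= first_coord_cons.
Qed.

(** Once the rank [n] factors are multiplied away, what remains is the inverse of the factors with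
    positive first coordinate. Its slices at first coordinate 0 and 1 can be computed directly. *)
Let low := mul_factors cons_roots (@partition_fun n.+1).

Let support_low : support_ge first_coord 0 low.
Proof.
apply: support_mul_factors.
  by move=> _ /mapP[k _ ->]; rewrite /= first_coord_cons.
by apply: support_partition_fun; apply: first_root_ge0.
Qed.

(** A factor whose root has first coordinate 0 acts inside each slice of constant first
    coordinate. *)
Let low_cons x mu : low (cons_weight x mu) =
  mul_factors (root_enum n) (fun nu => partition_fun (cons_weight x nu)) mu.
Proof.
rewrite /low /cons_roots; have: {subset root_enum n <= pos_roots n}.
  by move=> alpha; rewrite mem_root_enum.
elim: (root_enum n) mu => //= alpha s IHs mu sub.
have subs : {subset s <= pos_roots n} by move=> b bs; rewrite sub // inE bs orbT.
rewrite /mul_factor cons_weightB subr0 !IHs // root_var_cons0 //.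
by rewrite sub ?mem_head.
Qed.

Let mul_factor_cons0 f k c mu : support_ge first_coord 0 f -> 0 < c ->
  mul_factor (cons_weight c k) f (cons_weight 0 mu) = f (cons_weight 0 mu).
Proof.
move=> supp c_gt0; rewrite /mul_factor [f (_ - _)]supp; first by rewrite mulr0 subr0.
by rewrite cons_weightB /= first_coord_cons sub0r oppr_lt0.
Qed.

Let support_short f ks : support_ge first_coord 0 f ->
  support_ge first_coord 0 (mul_factors [seq cons_weight 1 k | k <- ks] f).
Proof.
move=> supp; apply: support_mul_factors => // _ /mapP[k _ ->] /=.
by rewrite first_coord_cons.
Qed.

Let short_cons0 f ks mu : support_ge first_coord 0 f ->
  mul_factors [seq cons_weight 1 k | k <- ks] f (cons_weight 0 mu) =
  f (cons_weight 0 mu).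
Proof.
move=> supp; elim: ks => //= k ks IHks.
by rewrite mul_factor_cons0 //; apply: support_short.
Qed.

(** Each root in the list lowers the first coordinate by 1, so from level 1 any product of two of
    them lands below the support. Only the terms linear in [tvar] survive. *)
Let short_cons1 f ks mu : support_ge first_coord 0 f ->
  mul_factors [seq cons_weight 1 k | k <- ks] f (cons_weight 1 mu) =
  f (cons_weight 1 mu) - tvar * \sum_(k <- ks) f (cons_weight 0 (mu - k)).
Proof.
move=> supp; elim: ks => [|k ks IHks] /=; first by rewrite big_nil mulr0 subr0.
rewrite /mul_factor IHks cons_weightB subrr short_cons0 // big_cons.
rewrite (@root_var_odd _ ord0) ?cons_weight0 //.
by rewrite mulrDr [X in _ = _ - X]addrC opprD addrA.
Qed.

Let units := [seq unit_weight p | p : 'I_n * bool].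

Let all_factors mu :
  mul_factors (eps ord0 *+ 2 :: first_short_roots ++ cons_roots)
    (@partition_fun n.+1) mu = (mu == 0)%:R.
Proof. by rewrite -(perm_mul_factors _ root_enum_cons) -partition_fun_generating. Qed.

Let all_factorsE : mul_factors (eps ord0 *+ 2 :: first_short_roots ++ cons_roots)
    (@partition_fun n.+1) =
  mul_factor (cons_weight 2 0) (mul_factors first_short_roots low).
Proof. by rewrite -eps_long_cons /low /mul_factors -foldr_cat. Qed.

Let low_cons0 mu : low (cons_weight 0 mu) = (mu == 0)%:R.
Proof.
have := all_factors (cons_weight 0 mu); rewrite all_factorsE mul_factor_cons0 //.
  by rewrite short_cons0 // cons_weight_eq0 eqxx.
exact: support_short.
Qed.

Let low_cons1 mu :
  low (cons_weight 1 mu) = tvar * \sum_(k <- units) (mu - k == 0)%:R.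
Proof.
have := all_factors (cons_weight 1 mu); rewrite all_factorsE /mul_factor.
(* The long root shifts level 1 to level -1, outside the support. *)
rewrite [mul_factors _ _ (_ - _)](support_short _ support_low); last first.
  by rewrite cons_weightB /= first_coord_cons.
rewrite mulr0 subr0 short_cons1 // cons_weight_eq0 /= => /eqP.
by rewrite subr_eq0 => /eqP->; congr (_ * _); apply: eq_bigr => k _; rewrite low_cons0.
Qed.

Lemma partition_fun_cons0 (mu : weight n) :
  partition_fun (cons_weight 0 mu) = partition_fun mu.
Proof.
apply: (@partition_fun_unique _ (@height n) (fun nu => partition_fun (cons_weight 0 nu))).
- by move=> alpha /height_pos_root; apply: lt_le_trans.
- move=> nu lt_nu; apply: support_partition_fun_height.
  by rewrite /= height_cons mul0r add0r.
- by move=> nu; rewrite -low_cons low_cons0.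
Qed.

Lemma partition_fun_cons1 (mu : weight n) :
  partition_fun (cons_weight 1 mu) =
  tvar * \sum_p partition_fun (mu - unit_weight p).
Proof.
pose f nu := tvar * \sum_(k <- units) @partition_fun n (nu - k).
transitivity (f mu); last by rewrite /f /units big_map big_enum.
(* The bound serves both sides: prepending 1 adds [n.+1] to the height, and [unit_weight p] has
   height at least [- n]. *)
apply: (@mul_factors_inj _ (@height n) (- n.+1%:Z) (root_enum n)
          (fun nu => partition_fun (cons_weight 1 nu)) f).
- move=> alpha; rewrite mem_root_enum => /height_pos_root; exact: lt_le_trans.
- move=> nu lt_nu; apply: support_partition_fun_height.
  by rewrite /= height_cons mul1r addrC -ltrBrDr sub0r.
- move=> nu lt_nu; rewrite /f big1_seq ?mulr0 // => _ /andP[_ /imageP[[i b] _ ->]].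
  apply: support_partition_fun_height; rewrite /= raddfB /= subr_lt0.
  apply: lt_trans lt_nu (lt_le_trans _ (height_unit_weight_ge (i, b))).
  by rewrite ltrN2 ltz_nat.
- by move=> nu; rewrite -low_cons low_cons1 mul_factors_translates;
    congr (_ * _); apply: eq_bigr => k _; rewrite -partition_fun_generating.
Qed.

End FirstCoordinate.

Lemma Ztu_eqNr (x : Ztu) : x = - x -> x = 0.
Proof.
move=> xN; apply/polyP => i; apply/polyP => j; rewrite !coef0.
by have := congr1 (fun p : Ztu => p`_i`_j) xN;
  rewrite /= !coefN; move: (x`_i`_j) => y; lia.
Qed.

(** * Alternating sums over the Weyl group *)

Section Weyl.
Variable n : nat.
Implicit Types (v w : weyl n) (G : weight n -> Ztu) (la mu : weight n).

Lemma weyl_signE w : weyl_sign w = (-1) ^+ w.1 * \prod_i (-1) ^+ w.2 i.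
Proof.
rewrite /weyl_sign (_ : weyl_mx w = diag_mx (\row_i (-1) ^+ w.2 i) *m perm_mx w.1).
  rewrite det_mulmx det_diag det_perm mulrC; congr (_ * _).
  by apply: eq_bigr => i _; rewrite mxE.
apply/matrixP => i j; rewrite mul_diag_mx !mxE.
by case: eqP; rewrite ?mulr1 ?mulr0.
Qed.

(** The product follows the right action on row vectors: [v] acts first. Only the injectivity of
    translations is needed below, so no group structure is declared. *)
Definition weyl_mul v w : weyl n :=
  ((v.1 * w.1)%g, [ffun i => v.2 i (+) w.2 (v.1 i)]).

Lemma weyl_mx_mul v w : weyl_mx (weyl_mul v w) = weyl_mx v *m weyl_mx w.
Proof.
apply/matrixP => i j; rewrite !mxE (bigD1 (v.1 i)) //= big1 => [|k ki].
  rewrite !mxE eqxx addr0 permM ffunE signr_addb.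
  by case: eqP; rewrite ?mulr0.
by rewrite mxE eq_sym (negPf ki) mul0r.
Qed.

Lemma weyl_act_mul v w mu :
  weyl_act (weyl_mul v w) mu = weyl_act w (weyl_act v mu).
Proof. by rewrite /weyl_act weyl_mx_mul mulmxA. Qed.

Lemma weyl_sign_mul v w : weyl_sign (weyl_mul v w) = weyl_sign v * weyl_sign w.
Proof. by rewrite /weyl_sign weyl_mx_mul det_mulmx. Qed.

Lemma weyl_mul_injl w : injective (weyl_mul ^~ w).
Proof.
move=> [s d] [s' d'] [/mulIg eq_s /ffunP eq_d]; rewrite eq_s; congr (_, _).
by apply/ffunP => i; have := eq_d i; rewrite !ffunE /= eq_s => /addIb.
Qed.

Lemma weyl_mul_injr w : injective (weyl_mul w).
Proof.
move=> [s d] [s' d'] [/mulgI eq_s /ffunP eq_d]; rewrite eq_s; congr (_, _).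
apply/ffunP => i; have := eq_d ((w.1)^-1 i)%g.
by rewrite !ffunE /= permKV => /addbI.
Qed.

Lemma weyl_act_is_additive w : zmod_morphism (weyl_act w).
Proof. by move=> x y; rewrite /weyl_act mulmxBl. Qed.

HB.instance Definition _ w :=
  GRing.isZmodMorphism.Build (weight n) (weight n) (weyl_act w)
    (weyl_act_is_additive w).

Lemma weyl_act_eps w i : weyl_act w (eps i) = unit_weight (w.1 i, w.2 i).
Proof.
apply/rowP => j; rewrite -(permKV w.1 j) weyl_actE !mxE eqxx.
by rewrite (inj_eq perm_inj) /=; case: eqP => [->|]; rewrite ?mulr0.
Qed.

Lemma weyl_act_unit w p :
  weyl_act w (unit_weight p) = unit_weight (w.1 p.1, w.2 p.1 (+) p.2).
Proof.
rewrite /unit_weight /weyl_act -scalemxAl -[eps p.1 *m _]/(weyl_act w (eps p.1)).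
by rewrite weyl_act_eps /unit_weight scalerA /= signr_addb mulrC.
Qed.

Definition alt_sum G la : Ztu :=
  \sum_(w : weyl n) (weyl_sign w)%:~R * G (weyl_act w la).

Lemma eq_alt_sum G1 G2 la : G1 =1 G2 -> alt_sum G1 la = alt_sum G2 la.
Proof. by move=> eqG; apply: eq_bigr => w _; rewrite eqG. Qed.

(** Reindexing by translation by [w] turns the sum into its negative, and [Ztu] has no 2-torsion.
    The next lemma uses the translation on the other side. *)
Lemma alt_sum_fixed w G la :
  weyl_sign w = -1 -> weyl_act w la = la -> alt_sum G la = 0.
Proof.
move=> sgn_w fix_la; apply: Ztu_eqNr.
rewrite {1}/alt_sum (reindex_inj (@weyl_mul_injr w)) -sumrN /=.
apply: eq_bigr => v _.
by rewrite weyl_sign_mul sgn_w weyl_act_mul fix_la mulN1r intrN mulNr.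
Qed.

Lemma alt_sum_invariant w G la :
  weyl_sign w = -1 -> (forall mu, G (weyl_act w mu) = G mu) -> alt_sum G la = 0.
Proof.
move=> sgn_w G_w; apply: Ztu_eqNr.
rewrite {1}/alt_sum (reindex_inj (@weyl_mul_injl w)) -sumrN /=.
apply: eq_bigr => v _.
by rewrite weyl_sign_mul sgn_w weyl_act_mul G_w mulrN1 intrN mulNr.
Qed.

Definition swap i j : weyl n := (tperm i j, [ffun=> false]).
Definition flip i : weyl n := (1%g, [ffun k => k == i]).

Lemma weyl_sign_swap i j : i != j -> weyl_sign (swap i j) = -1.
Proof.
move=> ij; rewrite weyl_signE odd_tperm ij big1 ?mulr1 // => k _.
by rewrite ffunE.
Qed.

Lemma weyl_sign_flip i : weyl_sign (flip i) = -1.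
Proof.
rewrite weyl_signE odd_perm1 mul1r (bigD1 i) //= ffunE eqxx big1 ?mulr1 // => k ki.
by rewrite ffunE (negPf ki).
Qed.

Lemma weyl_act_swapE i j mu k : weyl_act (swap i j) mu 0 k = mu 0 (tperm i j k).
Proof.
by have := weyl_actE (swap i j) mu (tperm i j k); rewrite /= tpermK ffunE mul1r.
Qed.

Lemma weyl_act_flipE i mu k :
  weyl_act (flip i) mu 0 k = if k == i then - mu 0 k else mu 0 k.
Proof.
have := weyl_actE (flip i) mu k; rewrite /= perm1 ffunE => ->.
by case: eqP; rewrite ?mulN1r ?mul1r.
Qed.

Lemma alt_sum_eq_coord G la i j : i != j -> la 0 i = la 0 j -> alt_sum G la = 0.
Proof.
move=> ij eq_la; apply: (alt_sum_fixed _ (weyl_sign_swap ij)).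
by apply/rowP => k; rewrite weyl_act_swapE; case: tpermP => [->|->|].
Qed.

Lemma alt_sum_zero_coord G la i : la 0 i = 0 -> alt_sum G la = 0.
Proof.
move=> la_i; apply: (alt_sum_fixed _ (weyl_sign_flip i)).
by apply/rowP => k; rewrite weyl_act_flipE; case: eqP => // ->; rewrite la_i oppr0.
Qed.

(* Tensoring with the vector representation: the weights [unit_weight p] form
   a single Weyl orbit. *)
Lemma alt_sum_orbit (G : weight n -> Ztu) la :
  \sum_p alt_sum (fun nu => G (nu + unit_weight p)) la =
  \sum_p alt_sum G (la + unit_weight p).
Proof.
rewrite exchange_big [RHS]exchange_big; apply: eq_bigr => w _ /=.
rewrite -!mulr_sumr; congr (_ * _).
under [RHS]eq_bigr do rewrite raddfD /= weyl_act_unit.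
rewrite (reindex_inj (h := fun p : 'I_n * bool => (w.1 p.1, w.2 p.1 (+) p.2))) //.
by move=> [i b] [j c] /= [/perm_inj-> /addbI->].
Qed.

End Weyl.

(** * Expansion of alternating sums along the first coordinate *)

Section FirstCoordinateSum.
Variable n : nat.

(** The pair [x.1] records which coordinate is moved to the front and whether it is negated; [x.2]
    acts on the remaining coordinates. *)
Definition weyl_lift (x : 'I_n.+1 * bool * weyl n) : weyl n.+1 :=
  (lift_perm x.1.1 ord0 x.2.1,
   [ffun k => if unlift x.1.1 k is Some k' then x.2.2 k' else x.1.2]).

(** Injectivity suffices, because both sides have [2 ^ n.+1 * (n.+1)!] elements. *)
Lemma weyl_lift_bij : bijective weyl_lift.
Proof.
apply: inj_card_bij; last first.
  by rewrite !card_prod !card_ffun !card_Sn !card_bool !card_ord factS expnS; lia.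
move=> [[i b] [s d]] [[i' b'] [s' d']] [/permP eq_s /ffunP eq_d].
have eq_i : i = i'.
  by apply: (@perm_inj _ (lift_perm i' ord0 s')); rewrite -eq_s /= !lift_perm_id.
rewrite -{i'}eq_i in eq_s eq_d *; congr (_, _, (_, _)).
- by have := eq_d i; rewrite !ffunE /= unlift_none.
- apply/permP => k; have := eq_s (lift i k).
  by rewrite /= !lift_perm_lift => /lift_inj.
- by apply/ffunP => k; have := eq_d (lift i k); rewrite !ffunE /= liftK.
Qed.

Lemma weyl_sign_lift x :
  weyl_sign (weyl_lift x) = (-1) ^+ (x.1.1 + x.1.2) * weyl_sign x.2.
Proof.
rewrite !weyl_signE /= odd_lift_perm addbF (bigD1_ord x.1.1) //= ffunE unlift_none.
under eq_bigr do rewrite ffunE liftK.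
by rewrite signr_addb signr_odd exprD mulrACA.
Qed.

Lemma weyl_act_lift x (la : weight n.+1) :
  weyl_act (weyl_lift x) la =
  cons_weight ((-1) ^+ x.1.2 * la 0 x.1.1) (weyl_act x.2 (col' x.1.1 la)).
Proof.
apply: cons_weight_ext; rewrite ?cons_weight0.
  have := weyl_actE (weyl_lift x) la x.1.1.
  by rewrite /= lift_perm_id ffunE unlift_none.
move=> j; rewrite cons_weightS -(permKV x.2.1 j) weyl_actE [X in _ * X]mxE.
have := weyl_actE (weyl_lift x) la (lift x.1.1 (x.2.1^-1 j)%g).
by rewrite /= lift_perm_lift ffunE liftK.
Qed.

Lemma alt_sum_cons (G : weight n.+1 -> Ztu) la :
  alt_sum G la = \sum_(i < n.+1) \sum_(b : bool) (-1) ^+ (i + b) *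
    alt_sum (fun nu => G (cons_weight ((-1) ^+ b * la 0 i) nu)) (col' i la).
Proof.
rewrite /alt_sum (reindex weyl_lift); last exact/onW_bij/weyl_lift_bij.
rewrite pair_big /=.
under [RHS]eq_bigr do rewrite mulr_sumr.
rewrite pair_big /=; apply: eq_bigr => x _.
by rewrite weyl_sign_lift weyl_act_lift rmorphM /= rmorphXn rmorphN1 mulrA.
Qed.

End FirstCoordinateSum.

Lemma sum_unit_weightN n (F : weight n -> Ztu) :
  \sum_p F (- unit_weight p) = \sum_p F (unit_weight p).
Proof.
rewrite (reindex_inj (h := fun p : 'I_n * bool => (p.1, ~~ p.2))) /=; last first.
  by move=> [i b] [j c] /= [-> /negb_inj->].
by apply: eq_bigr => p _; rewrite !unit_weightE /=; case: p.2; rewrite ?opprK.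
Qed.

Lemma sum_unit_weight n (F : weight n -> Ztu) :
  \sum_p F (unit_weight p) = \sum_i (F (eps i) + F (- eps i)).
Proof.
rewrite -(pair_big predT predT (fun i b => F (unit_weight (i, b)))) /=.
by apply: eq_bigr => i _; rewrite big_bool !unit_weightE addrC.
Qed.

(** The Kostka-Foulkes sum in [rho]-shifted weights, with an arbitrary weight in second place.
    Taking [eta = rho n + k] amounts to inserting e^(-k) in the constant term [E_n]. *)
Definition alt_partition n (la eta : weight n) : Ztu :=
  alt_sum (fun nu => partition_fun (nu - eta)) la.

(** * Simple reflections and insertions next to [rho] *)

Section SimpleReflections.
Variable n : nat.
Implicit Types (la eta alpha : weight n) (i j k l : 'I_n).

(** The difference of the two sides is the alternating sum of the partition function multiplied by
    the factor of [alpha]. That kernel is invariant under [w], and so is its translate by the fixed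
    weight [eta]; hence the sum vanishes. *)
Lemma alt_partition_refl (w : weyl n) alpha la eta :
  alpha \in pos_roots n -> weyl_sign w = -1 -> involutive (weyl_act w) ->
  weyl_act w alpha = - alpha -> weyl_act w eta = eta ->
  (forall beta, beta \in pos_roots n -> beta != alpha ->
     weyl_act w beta \in pos_roots n) ->
  (forall beta, beta \in pos_roots n -> beta != alpha ->
     root_var (weyl_act w beta) = root_var beta) ->
  alt_partition la eta = root_var alpha * alt_partition la (eta + alpha).
Proof.
move=> alpha_root sgn_w wK w_alpha w_eta w_root w_var.
apply/eqP; rewrite -subr_eq0 /alt_partition /alt_sum mulr_sumr -sumrB; apply/eqP.
transitivity (alt_sum (fun nu => mul_factor alpha (@partition_fun n) (nu - eta)) la).
  by apply: eq_bigr => v _; rewrite /mul_factor opprD addrA mulrBr mulrCA.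
apply: (alt_sum_invariant _ sgn_w) => nu; rewrite -{1}w_eta -raddfB.
exact: (mul_factor_partition_fun_refl wK alpha_root w_alpha w_root w_var).
Qed.

Lemma weyl_act_swap_eps i j k : weyl_act (swap i j) (eps k) = eps (tperm i j k).
Proof. by rewrite weyl_act_eps unit_weightE /= ffunE. Qed.

Lemma weyl_act_flip_eps i k :
  weyl_act (flip i) (eps k) = if k == i then - eps k else eps k.
Proof. by rewrite weyl_act_eps unit_weightE /= ffunE perm1. Qed.

Lemma weyl_act_swapK i j : involutive (weyl_act (swap i j)).
Proof. by move=> mu; apply/rowP => k; rewrite !weyl_act_swapE tpermK. Qed.

Lemma weyl_act_flipK i : involutive (weyl_act (flip i)).
Proof.
move=> mu; apply/rowP => k; rewrite !weyl_act_flipE.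
by case: eqP; rewrite ?opprK.
Qed.

(** An adjacent transposition inverts a single pair. *)
Lemma tperm_adjacent_lt i j k l : j = i.+1 :> nat -> (k < l)%N ->
  (k, l) != (i, j) -> (tperm i j k < tperm i j l)%N.
Proof.
move=> ji kl ne; have {}ne : ~~ ((k == i :> nat) && (l == j :> nat)) by [].
case: tpermP => [?|?|/eqP + /eqP]; case: tpermP => [?|?|/eqP + /eqP];
  subst; rewrite -?val_eqE /=; move: ne; rewrite /=; lia.
Qed.

Lemma swap_root i j (beta : weight n) : j = i.+1 :> nat ->
  beta \in pos_roots n -> beta != eps i - eps j ->
  weyl_act (swap i j) beta \in pos_roots n.
Proof.
move=> ji /pos_rootP[k l kl|k l kl|k] ne.
- rewrite raddfB /= !weyl_act_swap_eps pos_root_diff // tperm_adjacent_lt //.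
  by apply: contra ne => /eqP[-> ->].
- rewrite raddfD /= !weyl_act_swap_eps pos_root_sum // (inj_eq perm_inj).
  by apply/eqP => e; rewrite e ltnn in kl.
- by rewrite raddfMn /= weyl_act_swap_eps pos_root_long.
Qed.

Lemma swap_root_var i j (beta : weight n) :
  beta \in pos_roots n -> root_var (weyl_act (swap i j) beta) = root_var beta.
Proof.
move=> /pos_rootP[k l kl|k l kl|k].
- have ne : k != l by apply/eqP => e; rewrite e ltnn in kl.
  by rewrite raddfB /= !weyl_act_swap_eps !root_var_diff // (inj_eq perm_inj).
- have ne : k != l by apply/eqP => e; rewrite e ltnn in kl.
  by rewrite raddfD /= !weyl_act_swap_eps !root_var_sum // (inj_eq perm_inj).
- by rewrite raddfMn /= weyl_act_swap_eps !root_var_long.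
Qed.

(** As [i] is the last index, it can only be the second index of a short root, so the sign change
    exchanges [eps k - eps i] and [eps k + eps i]. *)
Lemma flip_root i (beta : weight n) : n = i.+1 ->
  beta \in pos_roots n -> beta != eps i *+ 2 ->
  weyl_act (flip i) beta \in pos_roots n.
Proof.
move=> ni /pos_rootP[k l kl|k l kl|k] ne.
- have ki : k == i = false.
    by apply/eqP => e; move: kl (ltn_ord l); rewrite e; lia.
  rewrite raddfB /= !weyl_act_flip_eps ki.
  case: eqP => _; last exact: pos_root_diff.
  by rewrite opprK pos_root_sum //; apply/eqP => e; rewrite e ltnn in kl.
- have ki : k == i = false.
    by apply/eqP => e; move: kl (ltn_ord l); rewrite e; lia.
  rewrite raddfD /= !weyl_act_flip_eps ki.
  case: eqP => _; first exact: pos_root_diff.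
  by rewrite pos_root_sum //; apply/eqP => e; rewrite e ltnn in kl.
- rewrite raddfMn /= weyl_act_flip_eps; case: eqP => [e|_].
    by rewrite e eqxx in ne.
  exact: pos_root_long.
Qed.

Lemma flip_root_var i (beta : weight n) : n = i.+1 ->
  beta \in pos_roots n -> beta != eps i *+ 2 ->
  root_var (weyl_act (flip i) beta) = root_var beta.
Proof.
move=> ni /pos_rootP[k l kl|k l kl|k] ne.
- have ki : k == i = false.
    by apply/eqP => e; move: kl (ltn_ord l); rewrite e; lia.
  have kl' : k != l by apply/eqP => e; rewrite e ltnn in kl.
  rewrite raddfB /= !weyl_act_flip_eps ki root_var_diff //.
  by case: eqP => _; rewrite ?opprK ?root_var_sum ?root_var_diff.
- have ki : k == i = false.
    by apply/eqP => e; move: kl (ltn_ord l); rewrite e; lia.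
  have kl' : k != l by apply/eqP => e; rewrite e ltnn in kl.
  rewrite raddfD /= !weyl_act_flip_eps ki root_var_sum //.
  by case: eqP => _; rewrite ?root_var_sum ?root_var_diff.
- rewrite raddfMn /= weyl_act_flip_eps; case: eqP => [e|//].
  by rewrite e eqxx in ne.
Qed.

Lemma rhoE i : rho n 0 i = (n - i)%:Z.
Proof. by rewrite mxE. Qed.

Lemma weyl_act_swap_rho i j : j = i.+1 :> nat ->
  weyl_act (swap i j) (rho n) = rho n - (eps i - eps j).
Proof.
move=> ji; have ij : (i == j) = false by apply/eqP => e; rewrite e in ji; lia.
apply/rowP => k; rewrite weyl_act_swapE [in RHS]mxE [X in _ + X]mxE.
rewrite [(eps i - _) _ _]mxE [(- eps j) _ _]mxE !epsE !rhoE.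
have := ltn_ord j.
case: tpermP => [->|->|/eqP ki /eqP kj].
- by rewrite eqxx eq_sym ij; lia.
- by rewrite eqxx ij; lia.
- by rewrite ![_ == k]eq_sym (negPf ki) (negPf kj); lia.
Qed.

Lemma weyl_act_flip_rho i : n = i.+1 ->
  weyl_act (flip i) (rho n) = rho n - eps i *+ 2.
Proof.
move=> ni; apply/rowP => k; rewrite weyl_act_flipE.
rewrite [in RHS]mxE [X in _ + X]mxE mulmxnE epsE !rhoE eq_sym.
by have := ltn_ord k; case: eqP => [<-|_] /=; rewrite mulr2n; lia.
Qed.

(** Coordinates [i] and [j] of [rho n - eps i] agree, so the simple reflection fixes this weight;
    adding the simple root gives [rho n - eps j]. *)
Lemma alt_partition_rhoB la i j : j = i.+1 :> nat ->
  alt_partition la (rho n - eps i) = tvar * alt_partition la (rho n - eps j).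
Proof.
move=> ji; have ij : (i < j)%N by rewrite ji.
have ne : i != j by apply/eqP => e; rewrite e ltnn in ij.
rewrite (@alt_partition_refl (swap i j) (eps i - eps j)).
- by rewrite root_var_diff // addrA subrK.
- exact: pos_root_diff.
- exact: weyl_sign_swap.
- exact: weyl_act_swapK.
- by rewrite raddfB /= !weyl_act_swap_eps tpermL tpermR opprB.
- rewrite raddfB /= weyl_act_swap_rho // weyl_act_swap_eps tpermL.
  by rewrite opprB addrA addrAC addrK.
- by move=> beta; apply: swap_root.
- by move=> beta inb _; apply: swap_root_var.
Qed.

(** Here coordinates [i] and [j] of [rho n + eps j] agree. *)
Lemma alt_partition_rhoD la i j : j = i.+1 :> nat ->
  alt_partition la (rho n + eps j) = tvar * alt_partition la (rho n + eps i).
Proof.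
move=> ji; have ij : (i < j)%N by rewrite ji.
have ne : i != j by apply/eqP => e; rewrite e ltnn in ij.
rewrite (@alt_partition_refl (swap i j) (eps i - eps j)).
- by rewrite root_var_diff // [eps i - _]addrC addrA addrK.
- exact: pos_root_diff.
- exact: weyl_sign_swap.
- exact: weyl_act_swapK.
- by rewrite raddfB /= !weyl_act_swap_eps tpermL tpermR opprB.
- rewrite raddfD /= weyl_act_swap_rho // weyl_act_swap_eps tpermR.
  by rewrite opprB addrA subrK.
- by move=> beta; apply: swap_root.
- by move=> beta inb _; apply: swap_root_var.
Qed.

(** The last coordinate of [rho n - eps i] is 0, so the sign change fixes it. *)
Lemma alt_partition_rho_last la i : n = i.+1 ->
  alt_partition la (rho n - eps i) = uvar * alt_partition la (rho n + eps i).
Proof.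
move=> ni; rewrite (@alt_partition_refl (flip i) (eps i *+ 2)).
- by rewrite root_var_long mulr2n addrA subrK.
- exact: pos_root_long.
- exact: weyl_sign_flip.
- exact: weyl_act_flipK.
- by rewrite raddfMn /= weyl_act_flip_eps eqxx mulNrn.
- rewrite raddfB /= weyl_act_flip_rho // weyl_act_flip_eps eqxx opprK.
  by rewrite mulr2n opprD addrA subrK.
- by move=> beta; apply: flip_root.
- by move=> beta; apply: flip_root_var.
Qed.

End SimpleReflections.

(** The insertions form one chain, from [+ eps] at the first index to the last, then from [- eps] at
    the last index back to the first. Each step costs [tvar], except the turn in the middle, which
    costs [uvar]. The sum is therefore two geometric series, and [1 - tvar] clears their
    denominators. *)
Lemma sum_alt_partition_unit n (la : weight n.+1) :
  (1 - tvar) * \sum_p alt_partition la (rho n.+1 + unit_weight p) =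
  (1 - tvar ^+ n.+1) * (1 + uvar * tvar ^+ n) *
    alt_partition la (rho n.+1 + eps ord0).
Proof.
set g0 := alt_partition la (rho n.+1 + eps ord0).
have gE k (lt_k : (k < n.+1)%N) :
    alt_partition la (rho n.+1 + eps (Ordinal lt_k)) = tvar ^+ k * g0.
  elim: k lt_k => [|k IHk] lt_k.
    by rewrite mul1r /g0; congr (alt_partition _ (_ + eps _)); apply: val_inj.
  by rewrite (@alt_partition_rhoD _ _ (Ordinal (ltnW lt_k))) // IHk exprS mulrA.
have fE k (lt_k : (n - k < n.+1)%N) : (k <= n)%N ->
    alt_partition la (rho n.+1 - eps (Ordinal lt_k)) =
    tvar ^+ k * (uvar * (tvar ^+ n * g0)).
  elim: k lt_k => [|k IHk] lt_k le_kn.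
    by rewrite alt_partition_rho_last ?gE ?subn0 ?mul1r //= subn0.
  have lt_k' : (n - k < n.+1)%N by lia.
  rewrite (@alt_partition_rhoB _ _ _ (Ordinal lt_k')) /=; last by lia.
  by rewrite IHk ?exprS ?mulrA //; lia.
rewrite (sum_unit_weight (fun k => alt_partition la (rho n.+1 + k))) big_split /=.
have -> : \sum_i alt_partition la (rho n.+1 + eps i) =
    (\sum_(i < n.+1) tvar ^+ i) * g0.
  by rewrite mulr_suml; apply: eq_bigr => -[i lt_i] _; apply: gE.
have -> : \sum_i alt_partition la (rho n.+1 - eps i) =
    (\sum_(i < n.+1) tvar ^+ i) * (uvar * (tvar ^+ n * g0)).
  rewrite mulr_suml (reindex_inj rev_ord_inj); apply: eq_bigr => -[i lt_i] _ /=.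
  have lt_ni : (n - i < n.+1)%N by lia.
  by rewrite -(fE i lt_ni) //; congr (alt_partition _ (_ - eps _)).
have -> : 1 - tvar ^+ n.+1 = (1 - tvar) * \sum_(i < n.+1) tvar ^+ i.
  by rewrite -opprB subrX1 -mulNr opprB.
ring.
Qed.

(** * Lowering the rank by one *)

Section FirstRow.
Variable n : nat.
Implicit Types (la : weight n.+1) (mu eta : weight n) (x y : int).

(** The terms with a sign change at the front have first coordinate [- la 0 i - y < 0] and
    vanish. *)
Lemma alt_partition_cons la y eta : 0 < y -> (forall i, 0 <= la 0 i) ->
  alt_partition la (cons_weight y eta) = \sum_(i < n.+1) (-1) ^+ i *
    alt_sum (fun nu => partition_fun (cons_weight (la 0 i - y) (nu - eta)))
      (col' i la).
Proof.
move=> y_gt0 la_ge0; rewrite /alt_partition alt_sum_cons; apply: eq_bigr => i _.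
rewrite big_bool /= [X in X + _](_ : _ = 0) ?add0r.
  rewrite addn0 mul1r; congr (_ * _); apply: eq_alt_sum => nu.
  by rewrite cons_weightB.
rewrite /alt_sum big1 ?mulr0 // => w _.
rewrite cons_weightB partition_fun_cons_lt0 ?mulr0 // mulN1r.
by have := la_ge0 i; lia.
Qed.

(** A combined rewriting rule for [x <= 1]; for larger [x] the last branch returns the sum
    unchanged. *)
Lemma alt_sum_partition_cons x eta mu : alt_sum
    (fun nu => partition_fun (cons_weight x (nu - eta))) mu =
  if x < 0 then 0 else if x == 0 then alt_partition mu eta else
  if x == 1 then tvar * \sum_p alt_partition mu (eta + unit_weight p) else
  alt_sum (fun nu => partition_fun (cons_weight x (nu - eta))) mu.
Proof.
case: ifP => [x_lt0|_].
  by rewrite /alt_sum big1 // => w _; rewrite partition_fun_cons_lt0 ?mulr0.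
case: eqP => [->|_]; first by apply: eq_alt_sum => nu; rewrite partition_fun_cons0.
case: eqP => [->|//]; rewrite exchange_big mulr_sumr; apply: eq_bigr => w _ /=.
rewrite partition_fun_cons1 -mulr_sumr mulrCA; congr (_ * (_ * _)).
by apply: eq_bigr => p _; rewrite opprD addrA.
Qed.

(** Only the first coordinate reaches [y]; moving any other one to the front gives a negative
    difference. *)
Lemma alt_partition_cons_eq y mu eta : 0 < y -> (forall i, 0 <= mu 0 i < y) ->
  alt_partition (cons_weight y mu) (cons_weight y eta) = alt_partition mu eta.
Proof.
move=> y_gt0 mu_y; rewrite alt_partition_cons //; last first.
  move=> i; case: (unliftP ord0 i) => [j|] ->; rewrite ?cons_weight0 ?cons_weightS //.
    by case/andP: (mu_y j).
  exact: ltW.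
rewrite big_ord_recl big1 ?addr0 => [|i _].
  by rewrite mul1r cons_weight0 cons_weight_col' alt_sum_partition_cons subrr.
rewrite alt_sum_partition_cons cons_weightS subr_lt0.
by case/andP: (mu_y i) => _ ->; rewrite mulr0.
Qed.

Lemma alt_partition_cons_small y la eta : (forall i, 0 <= la 0 i < y) ->
  alt_partition la (cons_weight y eta) = 0.
Proof.
move=> la_y; have y_gt0 : 0 < y.
  by case/andP: (la_y ord0); apply: le_lt_trans.
rewrite alt_partition_cons // => [|i]; last by case/andP: (la_y i).
rewrite big1 // => i _; rewrite alt_sum_partition_cons subr_lt0.
by case/andP: (la_y i) => _ ->; rewrite mulr0.
Qed.

Lemma alt_partition_cons_succ y mu eta : 0 < y -> (forall i, 0 <= mu 0 i < y) ->
  alt_partition (cons_weight (y + 1) mu) (cons_weight y eta) =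
  tvar * \sum_p alt_partition mu (eta + unit_weight p).
Proof.
move=> y_gt0 mu_y; rewrite alt_partition_cons //; last first.
  move=> i; case: (unliftP ord0 i) => [j|] ->; rewrite ?cons_weight0 ?cons_weightS //.
    by case/andP: (mu_y j).
  by rewrite addr_ge0 // ltW.
rewrite big_ord_recl big1 ?addr0 => [|i _].
  rewrite mul1r cons_weight0 cons_weight_col' alt_sum_partition_cons.
  by rewrite addrAC subrr.
rewrite alt_sum_partition_cons cons_weightS subr_lt0.
by case/andP: (mu_y i) => _ ->; rewrite mulr0.
Qed.

End FirstRow.

(** Two coordinates can be moved to the front: [y + 1], which leaves the difference 1, and [y],
    which leaves the difference 0 and has sign -1. *)
Lemma alt_partition_cons_succ2 n y (mu : weight n) (eta : weight n.+1) :
  0 < y -> (forall i, 0 <= mu 0 i < y) ->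
  alt_partition (cons_weight (y + 1) (cons_weight y mu)) (cons_weight y eta) =
  tvar * \sum_p alt_partition (cons_weight y mu) (eta + unit_weight p)
  - alt_partition (cons_weight (y + 1) mu) eta.
Proof.
move=> y_gt0 mu_y; rewrite alt_partition_cons //; last first.
  move=> i; case: (unliftP ord0 i) => [j|] ->; rewrite ?cons_weight0 ?cons_weightS //.
    case: (unliftP ord0 j) => [k|] ->; rewrite ?cons_weight0 ?cons_weightS.
      by case/andP: (mu_y k).
    exact: ltW.
  by rewrite addr_ge0 // ltW.
rewrite !big_ord_recl big1 ?addr0 => [|i _].
  rewrite mul1r !cons_weight0 cons_weight_col' cons_weightS cons_weight0.
  rewrite [y + 1 - y]addrAC subrr add0r (alt_sum_partition_cons 1).
  rewrite (alt_sum_partition_cons 0) /= expr1 mulN1r.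
  congr (_ - alt_partition _ _); apply: cons_weight_ext.
    by rewrite mxE (_ : lift _ _ = ord0) ?cons_weight0 //; apply: val_inj.
  move=> j; rewrite mxE (_ : lift _ _ = lift ord0 (lift ord0 j)) ?cons_weightS //.
  exact: val_inj.
rewrite alt_sum_partition_cons !cons_weightS subr_lt0.
by case/andP: (mu_y i) => _ ->; rewrite mulr0.
Qed.

(** * Recurrence for the Kostka-Foulkes polynomials *)

Lemma tvarX_neq1 k : (0 < k)%N -> tvar ^+ k != 1.
Proof.
move=> k_gt0; rewrite /tvar -rmorphXn -[1]polyC1 (inj_eq polyC_inj).
apply/eqP => /(congr1 (fun p : {poly int} => size p)).
by rewrite /= size_polyXn size_poly1; case: k k_gt0.
Qed.

Lemma kostka_foulkesE n (la mu : weight n) :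
  kostka_foulkes la mu = alt_partition (la + rho n) (mu + rho n).
Proof. by []. Qed.

Lemma omega_rhoE n a (j : 'I_n) :
  (omega n a + rho n) 0 j = (j < a)%N%:Z + (n - j)%:Z.
Proof. by rewrite !mxE. Qed.

Lemma omega_rho_bound n a (j : 'I_n) : 0 <= (omega n a + rho n) 0 j < n.+2%:Z.
Proof. by rewrite omega_rhoE; case: (_ < a)%N; lia. Qed.

Lemma rho_bound n (j : 'I_n) : 0 <= rho n 0 j < n.+1%:Z.
Proof. by rewrite rhoE; lia. Qed.

Lemma omega_rho_consS n a :
  omega n.+1 a.+1 + rho n.+1 = cons_weight n.+2%:Z (omega n a + rho n).
Proof. by rewrite omega_consS rho_cons cons_weightD -PoszD add1n. Qed.

Lemma alt_partition_omegaS n a (eta : weight n) :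
  alt_partition (omega n.+1 a.+1 + rho n.+1) (cons_weight n.+2%:Z eta) =
  alt_partition (omega n a + rho n) eta.
Proof.
by rewrite omega_rho_consS alt_partition_cons_eq // => i; apply: omega_rho_bound.
Qed.

Lemma alt_partition_rho0 n (eta : weight n) :
  alt_partition (rho n.+1) (cons_weight n.+2%:Z eta) = 0.
Proof. by rewrite alt_partition_cons_small // => i; apply: rho_bound. Qed.

Lemma kostka_omegaSS n a b :
  kostka_foulkes (omega n.+1 a.+1) (omega n.+1 b.+1) =
  kostka_foulkes (omega n a) (omega n b).
Proof. by rewrite !kostka_foulkesE (omega_rho_consS n b) alt_partition_omegaS. Qed.

Lemma kostka_omega0S n b :
  kostka_foulkes (omega n.+1 0) (omega n.+1 b.+1) = 0.
Proof. by rewrite kostka_foulkesE omega_rho_consS omega0 add0r alt_partition_rho0. Qed.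

Lemma kostka_omega00 n : kostka_foulkes (omega n 0) (omega n 0) = 1.
Proof.
rewrite kostka_foulkesE omega0 add0r; elim: n => [|n IHn].
  (* In rank 0 the Weyl group is trivial and there is no root, so the generating identity itself
     gives the value 1. *)
  have all0 (mu : weight 0) : mu = 0 by apply/rowP => -[].
  rewrite /alt_partition /alt_sum (bigD1 (1%g, [ffun=> false])) //= big1 => [|w].
    rewrite /weyl_sign det_mx00 mul1r addr0 [_ - _]all0.
    have := @partition_fun_generating 0 0.
    suff -> : [seq ssval alpha | alpha : pos_root 0] = [::] by rewrite /= eqxx.
    have mem0 alpha : alpha \in pos_roots 0 = false by apply/negP => /pos_rootP[] -[].
    case E : [seq _ | _ : _] => [//|alpha s].
    by have := mem_root_enum alpha; rewrite mem0 /root_enum E mem_head.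
  case/eqP; case: w => s d; congr (_, _); first by apply/permP => -[].
  by apply/ffunP => -[].
by rewrite rho_cons alt_partition_cons_eq // => i; apply: rho_bound.
Qed.

(** The first row gives [tvar] times a sum of insertions, all proportional to the one at
    [rho + eps ord0]. That one vanishes, as its first coordinate exceeds every coordinate of
    [rho]. *)
Lemma kostka_omega10 n : kostka_foulkes (omega n.+1 1) (omega n.+1 0) = 0.
Proof.
rewrite kostka_foulkesE omega_rho_consS !omega0 !add0r rho_cons.
have -> : n.+2%:Z = n.+1%:Z + 1 by lia.
rewrite alt_partition_cons_succ // => [|i]; last exact: rho_bound.
case: n => [|n]; first by rewrite big1 ?mulr0 // => -[[]].
have := sum_alt_partition_unit (rho n.+1).
rewrite [X in _ * alt_partition _ X](_ : _ = cons_weight n.+2%:Z (rho n)).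
  rewrite alt_partition_rho0 mulr0 => /eqP; rewrite mulf_eq0 subr_eq0 eq_sym.
  by rewrite -[tvar]expr1 (negPf (tvarX_neq1 _)) // => /eqP->; rewrite mulr0.
by rewrite rho_cons eps_cons0 cons_weightD addr0 -PoszD addn1.
Qed.

(* Pieri rule for the vector representation: every other shifted weight
   [la + unit_weight p] is singular. *)
Lemma sum_alt_partition_omega n a : (a <= n)%N ->
  \sum_p alt_partition (omega n.+1 a.+1 + rho n.+1) (rho n.+1 + unit_weight p) =
  alt_partition (omega n.+1 a.+1 + rho n.+1 + eps ord0) (rho n.+1) +
  (if (a < n)%N then kostka_foulkes (omega n.+1 a.+2) (omega n.+1 0) else 0) +
  kostka_foulkes (omega n.+1 a) (omega n.+1 0).
Proof.
move=> le_an; set la := omega n.+1 a.+1 + rho n.+1.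
rewrite -(sum_unit_weightN (fun k => alt_partition la (rho n.+1 + k))).
transitivity (\sum_p alt_partition (la + unit_weight p) (rho n.+1)).
  have := alt_sum_orbit (fun nu => partition_fun (nu - rho n.+1)) la.
  apply: etrans; apply: eq_bigr => p _; apply: eq_alt_sum => nu.
  by rewrite opprB addrA addrAC.
rewrite (sum_unit_weight (fun k => alt_partition (la + k) (rho n.+1))) big_split /=.
have laE j : la 0 j = (j < a.+1)%N%:Z + (n.+1 - j)%:Z by rewrite omega_rhoE.
have addE i j : (la + eps i) 0 j = la 0 j + (i == j)%:R by rewrite mxE epsE.
have subE i j : (la - eps i) 0 j = la 0 j - (i == j)%:R by rewrite !mxE eqxx eq_sym.
rewrite !kostka_foulkesE !omega0 !add0r; congr (_ + _).
  rewrite big_ord_recl; congr (_ + _).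
  (* Adding 1 at position [i.+1] makes it equal to its left neighbour, except just after the last 1
     of [omega], where the gap is 2. For [a = n] that position does not exist. *)
  have zero (i : 'I_n) : i != a :> nat ->
      alt_partition (la + eps (lift ord0 i)) (rho n.+1) = 0.
    move=> ia; apply: (@alt_sum_eq_coord _ _ _ (widen_ord (leqnSn n) i) (lift ord0 i)).
      by rewrite -val_eqE /= /bump; lia.
    rewrite !addE eqxx -val_eqE /= !laE /= /bump /=; have := ltn_ord i.
    by case: eqP; case: (ltnP i a.+1); case: (ltnP (1 + i) a.+1); lia.
  case: ifP => [lt_an|ge_an].
    rewrite (bigD1 (Ordinal lt_an)) //= big1 ?addr0 => [|i]; last first.
      by rewrite -val_eqE; apply: zero.
    rewrite (_ : la + _ = omega n.+1 a.+2 + rho n.+1) //.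
    apply/rowP => j; rewrite addE (omega_rhoE a.+2) laE.
    by rewrite -val_eqE /= /bump /=; case: eqP; case: (ltnP j a.+1); case: (ltnP j a.+2); lia.
  by rewrite big1 // => i _; apply: zero; have := ltn_ord i; lia.
have lt_a : (a < n.+1)%N by [].
rewrite (bigD1 (Ordinal lt_a)) //= big1 ?addr0 => [|i].
  rewrite (_ : la - _ = omega n.+1 a + rho n.+1) //.
  apply/rowP => j; rewrite subE (omega_rhoE a) laE.
  by rewrite -val_eqE /=; case: eqP; case: (ltnP j a.+1); case: (ltnP j a); lia.
(* Subtracting 1 away from position [a] gives either a zero last coordinate or two equal
   neighbours. *)
rewrite -val_eqE /= => ia; have := ltn_ord i; rewrite ltnS leq_eqVlt => /orP[i_n|lt_in].
  apply: (@alt_sum_zero_coord _ _ _ i); rewrite subE eqxx laE (eqP i_n).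
  by move: ia; rewrite (eqP i_n); case: (ltnP n a.+1); lia.
have lt_i : (i.+1 < n.+1)%N by [].
apply: (@alt_sum_eq_coord _ _ _ i (Ordinal lt_i)).
  by rewrite -val_eqE /=; lia.
rewrite !subE eqxx -val_eqE !laE /=.
by case: eqP; case: (ltnP i a.+1); case: (ltnP i.+1 a.+1); lia.
Qed.

Lemma kostka_omega_rec n a : (a <= n)%N ->
  kostka_foulkes (omega n.+2 a.+2) (omega n.+2 0) =
  (if (a < n)%N then kostka_foulkes (omega n.+1 a.+2) (omega n.+1 0) else 0) +
  kostka_foulkes (omega n.+1 a) (omega n.+1 0) -
  (1 - tvar ^+ n.+1) * (1 + uvar * tvar ^+ n) *
    kostka_foulkes (omega n a) (omega n 0).
Proof.
move=> le_an; have eqS := sum_alt_partition_omega le_an.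
have := sum_alt_partition_unit (omega n.+1 a.+1 + rho n.+1).
rewrite [X in _ * alt_partition _ X](_ : _ = cons_weight n.+2%:Z (rho n)); last first.
  by rewrite rho_cons eps_cons0 cons_weightD addr0 -PoszD addn1.
rewrite alt_partition_omegaS.
have -> : alt_partition (omega n a + rho n) (rho n) =
    kostka_foulkes (omega n a) (omega n 0) by rewrite kostka_foulkesE omega0 add0r.
rewrite (kostka_foulkesE (omega n.+2 _) (omega n.+2 0)) (omega0 n.+2) add0r.
rewrite [omega n.+2 _ + _]omega_rho_consS [in cons_weight _ _]omega_rho_consS.
rewrite [rho n.+2]rho_cons.
have -> : n.+3%:Z = n.+2%:Z + 1 by lia.
rewrite alt_partition_cons_succ2 // => [|i]; last exact: omega_rho_bound.
rewrite -omega_rho_consS.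
have -> : cons_weight (n.+2%:Z + 1) (omega n a + rho n) =
    omega n.+1 a.+1 + rho n.+1 + eps ord0.
  by rewrite omega_rho_consS eps_cons0 cons_weightD addr0.
move: eqS; set S := \sum_p _; set A := alt_partition _ _.
set K1 := kostka_foulkes _ _; set K2 := kostka_foulkes _ _.
set K3 := kostka_foulkes _ _ => eqS eqS'; rewrite -eqS'.
(* The left side is [tvar * S - A]. Splitting off [(1 - tvar) * S] leaves [S - A], where the Pieri
   rule cancels the non-fundamental term [A]. *)
rewrite [in LHS](_ : tvar * S = S - (1 - tvar) * S); last by ring.
by rewrite [X in X - _ - _]eqS; ring.
Qed.

(** * The closed formula *)

Section Formula.
Variables (F : fieldType) (t u : F).
Hypothesis t_neq0 : t != 0.
Hypothesis tX_neq1 : forall k, (0 < k)%N -> t ^+ k != 1.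

(** [qfact] and [qfact2] are (t; t)_m and (t^2; t^2)_m. *)
Definition qfact m : F := \prod_(1 <= i < m.+1) (1 - t ^+ i).
Definition qfact2 m : F := \prod_(1 <= i < m.+1) (1 - t ^+ (2 * i)).

Let onem_neq0 k : (0 < k)%N -> 1 - t ^+ k != 0.
Proof. by move=> k_gt0; rewrite subr_eq0 eq_sym tX_neq1. Qed.

Lemma qfact0 : qfact 0 = 1. Proof. by rewrite /qfact big_nil. Qed.

Lemma qfactS m : qfact m.+1 = qfact m * (1 - t ^+ m.+1).
Proof. by rewrite /qfact big_nat_recr. Qed.

Lemma qfact20 : qfact2 0 = 1. Proof. by rewrite /qfact2 big_nil. Qed.

Lemma qfact2S m : qfact2 m.+1 = qfact2 m * (1 - t ^+ (2 * m.+1)).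
Proof. by rewrite /qfact2 big_nat_recr. Qed.

Lemma qfact_neq0 m : qfact m != 0.
Proof. by elim: m => [|m IHm]; rewrite ?qfact0 ?oner_neq0 // qfactS mulf_neq0 ?onem_neq0. Qed.

Lemma qfact2_neq0 m : qfact2 m != 0.
Proof. by elim: m => [|m IHm]; rewrite ?qfact20 ?oner_neq0 // qfact2S mulf_neq0 ?onem_neq0. Qed.

Lemma t_factE m : t_fact t m = qfact m / (1 - t) ^+ m.
Proof.
rewrite /t_fact /t_int; elim: m => [|m IHm]; first by rewrite qfact0 big_nil divr1.
by rewrite big_nat_recr //= IHm mulf_div -qfactS -exprSr.
Qed.

(** The factors of (t; t)_(2i) are split into odd and even exponents. *)
Lemma t_pochhammerE i : t_pochhammer t (t ^+ 2) i * qfact2 i = qfact (2 * i).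
Proof.
rewrite /t_pochhammer; elim: i => [|i IHi]; first by rewrite big_nil qfact20 qfact0 mul1r.
rewrite big_nat_recr //= qfact2S mulrACA IHi mulnS !qfactS -exprM -exprS.
by rewrite mulrA.
Qed.

(** The exponent is an integer, since it equals -1 at [i = 1]. *)
Definition t_sq i : F := t ^ ((i ^ 2)%N%:Z - (2 * i)%N%:Z).

Lemma t_sqS i : t_sq i.+1 = t_sq i * t ^+ (2 * i) / t.
Proof.
rewrite /t_sq -[t ^+ (2 * i)]/(t ^ (2 * i)%N%:Z) -[t^-1]exprN1 -!expfzDr //.
by congr (_ ^ _); rewrite !expnS !expn0; lia.
Qed.

(* Coefficient of (-u)^i in K_{omega_(2d), 0} in rank n; the multinomial of the
   theorem times (t; t^2)_i is rewritten with (t; t)_(2i) = (t; t^2)_i (t^2; t^2)_i. *)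
Definition kostka_coef n d i : F := if (i <= d)%N then
  t ^+ d * t_sq i * (1 - t ^+ (n.+1 - 2 * d)) * qfact n /
    (qfact2 i * qfact (d - i) * qfact (n.+1 - d - i)) else 0.

Lemma kostka_coef_gt n d i : (d < i)%N -> kostka_coef n d i = 0.
Proof. by rewrite /kostka_coef ltnNge => /negPf->. Qed.

(** The coefficient of (-u)^i in the recurrence; the term [u * t ^+ n] shifts the index by one and
    changes the sign. *)
Lemma kostka_coef_rec n d i : (2 * d <= n)%N ->
  kostka_coef n.+2 d.+1 i =
  kostka_coef n.+1 d.+1 i + kostka_coef n.+1 d i -
  (1 - t ^+ n.+1) * (kostka_coef n d i -
     t ^+ n * (if i is j.+1 then kostka_coef n d j else 0)).
Proof.
(* Writing [n = 2 * d + m] turns the truncated subtractions into explicit sums. Once all factorials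
   are reduced to common ones, each case is a rational identity in powers of [t]. *)
move=> le_dn; have [m ->] : exists m, n = (2 * d + m)%N.
  by exists (n - 2 * d)%N; lia.
have t1 : t != 0 by [].
case: (ltngtP i d.+1) => [lt_id|gt_id|->]; last 2 first.
- rewrite !kostka_coef_gt ?(ltnW gt_id) //.
  by case: i gt_id => [|j] gt_id; rewrite ?kostka_coef_gt //; ring.
- rewrite /kostka_coef leqnn ltnn leqnn !subnn qfact0.
  rewrite (_ : (2 * d + m).+3 - 2 * d.+1 = m.+1)%N; last by lia.
  rewrite (_ : (2 * d + m).+2 - 2 * d.+1 = m)%N; last by lia.
  rewrite (_ : (2 * d + m).+1 - 2 * d = m.+1)%N; last by lia.
  rewrite (_ : (2 * d + m).+3 - d.+1 - d.+1 = m.+1)%N; last by lia.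
  rewrite (_ : (2 * d + m).+2 - d.+1 - d.+1 = m)%N; last by lia.
  rewrite (_ : (2 * d + m).+1 - d - d = m.+1)%N; last by lia.
  rewrite t_sqS !qfactS qfact2S.
  have := qfact_neq0 m; have := qfact2_neq0 d.
  have : 1 - t ^+ m.+1 != 0 by exact: onem_neq0.
  have : 1 - t ^+ (2 * d.+1) != 0 by exact: onem_neq0.
  rewrite ![(2 * _)%N]mulnC !(exprS, exprM, exprD) !expr0 !mulr1 => h1 h2 h3 h4.
  by field; rewrite ?h1 ?h2 ?h3 ?h4 ?t1.
rewrite ltnS in lt_id; case: i lt_id => [_|j lt_jd].
- rewrite /kostka_coef !leq0n !subn0.
  rewrite (_ : (2 * d + m).+3 - 2 * d.+1 = m.+1)%N; last by lia.
  rewrite (_ : (2 * d + m).+2 - 2 * d.+1 = m)%N; last by lia.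
  rewrite (_ : (2 * d + m).+2 - 2 * d = m.+2)%N; last by lia.
  rewrite (_ : (2 * d + m).+1 - 2 * d = m.+1)%N; last by lia.
  rewrite (_ : (2 * d + m).+3 - d.+1 = (d + m).+2)%N; last by lia.
  rewrite (_ : (2 * d + m).+2 - d.+1 = (d + m).+1)%N; last by lia.
  rewrite [qfact (d + m).+2]qfactS [qfact d.+1]qfactS.
  rewrite [qfact (2 * d + m).+2]qfactS [qfact (2 * d + m).+1]qfactS qfact20.
  have := qfact_neq0 (d + m).+1; have := qfact_neq0 d.
  have : 1 - t ^+ (d + m).+2 != 0 by exact: onem_neq0.
  have : 1 - t ^+ d.+1 != 0 by exact: onem_neq0.
  rewrite ![(2 * _)%N]mulnC !(exprS, exprM, exprD) !expr0 !mulr1 => h1 h2 h3 h4.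
  by field; rewrite ?h1 ?h2 ?h3 ?h4 ?t1.
have [e dE] : exists e, d = (e + j.+1)%N by exists (d - j.+1)%N; lia.
rewrite /kostka_coef lt_jd (leqW lt_jd) (ltnW lt_jd).
rewrite (_ : (2 * d + m).+3 - 2 * d.+1 = m.+1)%N; last by lia.
rewrite (_ : (2 * d + m).+2 - 2 * d.+1 = m)%N; last by lia.
rewrite (_ : (2 * d + m).+2 - 2 * d = m.+2)%N; last by lia.
rewrite (_ : (2 * d + m).+1 - 2 * d = m.+1)%N; last by lia.
rewrite (_ : (2 * d + m).+3 - d.+1 - j.+1 = (e + m).+2)%N; last by lia.
rewrite (_ : (2 * d + m).+2 - d.+1 - j.+1 = (e + m).+1)%N; last by lia.
rewrite (_ : (2 * d + m).+1 - d - j = (e + m).+2)%N; last by lia.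
rewrite (_ : d.+1 - j.+1 = e.+1)%N; last by lia.
rewrite (_ : d - j.+1 = e)%N; last by lia.
rewrite (_ : d - j = e.+1)%N; last by lia.
rewrite [qfact (e + m).+2]qfactS [qfact e.+1]qfactS t_sqS qfact2S.
rewrite [qfact (2 * d + m).+2]qfactS [qfact (2 * d + m).+1]qfactS.
have := qfact_neq0 (e + m).+1; have := qfact_neq0 e; have := qfact2_neq0 j.
have : 1 - t ^+ (e + m).+2 != 0 by exact: onem_neq0.
have : 1 - t ^+ e.+1 != 0 by exact: onem_neq0.
have : 1 - t ^+ (2 * j.+1) != 0 by exact: onem_neq0.
move: (qfact _) (qfact _) (qfact _) (qfact2 _) (t_sq _) => q1 q2 q3 q4 q5.
rewrite dE ![(2 * _)%N]mulnC !mulSn !mulnDl !(exprS, exprM, exprD) !expr0 !mulr1.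
by move=> h1 h2 h3 h4 h5 h6; field; rewrite ?h1 ?h2 ?h3 ?h4 ?h5 ?h6 ?t1.
Qed.

Definition kostka_formula n d : F :=
  \sum_(0 <= i < d.+1) (- u) ^+ i * kostka_coef n d i.

(** This allows sums with different [d] to share one range. *)
Lemma kostka_formula_wide n d m : (d < m)%N ->
  \sum_(0 <= i < m) (- u) ^+ i * kostka_coef n d i = kostka_formula n d.
Proof.
move=> lt_dm; rewrite (big_cat_nat (leq0n _) lt_dm) /= [X in _ + X]big_nat_cond.
rewrite [X in _ + X]big1 ?addr0 // => i /andP[/andP[lt_di _] _].
by rewrite kostka_coef_gt ?mulr0.
Qed.

Lemma kostka_formula_rec n d : (2 * d <= n)%N ->
  kostka_formula n.+2 d.+1 = kostka_formula n.+1 d.+1 + kostka_formula n.+1 d -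
  (1 - t ^+ n.+1) * (1 + u * t ^+ n) * kostka_formula n d.
Proof.
move=> le_dn; pose prev i := if i is j.+1 then kostka_coef n d j else 0.
transitivity (\sum_(0 <= i < d.+2)
   ((- u) ^+ i * kostka_coef n.+1 d.+1 i + (- u) ^+ i * kostka_coef n.+1 d i -
    (1 - t ^+ n.+1) *
      ((- u) ^+ i * kostka_coef n d i - t ^+ n * ((- u) ^+ i * prev i)))).
  by apply: eq_bigr => i _; rewrite kostka_coef_rec // -/(prev i); ring.
rewrite sumrB big_split /= -mulr_sumr sumrB -mulr_sumr !kostka_formula_wide //.
have -> : \sum_(0 <= i < d.+2) (- u) ^+ i * prev i = - u * kostka_formula n d.
  rewrite big_nat_recl //= mulr0 add0r /kostka_formula mulr_sumr.
  by apply: eq_bigr => i _; rewrite exprS mulrA.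
ring.
Qed.

Lemma kostka_formula0 n : kostka_formula n 0 = 1.
Proof.
rewrite /kostka_formula big_nat1 /kostka_coef /t_sq subrr expr0z !expr0 !mul1r.
rewrite muln0 !subn0 qfact0 qfact20 !mul1r mulrC qfactS [X in _ * X]mulrC.
by rewrite mulVf // mulf_neq0 ?qfact_neq0 ?onem_neq0.
Qed.

(** The factor [1 - t ^+ (n.+1 - 2 * d)] is 0. This matches the zero branch of [kostka_omega_rec],
    where the index of [omega] exceeds the rank. *)
Lemma kostka_formula_vanish n d : (n.+1 = 2 * d)%N -> kostka_formula n d = 0.
Proof.
move=> nd; rewrite /kostka_formula big1 // => i _; rewrite /kostka_coef nd subnn.
by rewrite subrr; case: ifP => _; rewrite ?(mulr0, mul0r).
Qed.

Lemma kostka_formulaE n d : (2 * d <= n)%N ->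
  kostka_formula n d =
  t ^+ d * ((t ^+ (n.+1 - 2 * d) - 1) / (t ^+ n.+1 - 1)) *
  \sum_(0 <= i < d.+1) (- u) ^+ i *
     (t_sq i * t_multinomial t n.+1 (2 * i) (d - i) (n.+1 - d - i) *
      t_pochhammer t (t ^+ 2) i).
Proof.
move=> le_dn; rewrite /kostka_formula mulr_sumr [LHS]big_nat_cond [RHS]big_nat_cond.
apply: eq_bigr => i /andP[/andP[_ lt_id] _]; rewrite ltnS in lt_id.
rewrite mulrCA; congr (_ * _); rewrite /kostka_coef lt_id /t_multinomial !t_factE.
rewrite -!t_pochhammerE qfactS.
(* The lower entries of the multinomial add up to [n.+1], so the powers of [1 - t] cancel. *)
have expE : (1 - t) ^+ n.+1 =
    (1 - t) ^+ (2 * i) * (1 - t) ^+ (d - i) * (1 - t) ^+ (n.+1 - d - i).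
  by rewrite -!exprD; congr (_ ^+ _); lia.
rewrite expE.
have p_neq0 : t_pochhammer t (t ^+ 2) i != 0.
  by have := qfact_neq0 (2 * i); rewrite -t_pochhammerE mulf_eq0 negb_or => /andP[].
have t1 : 1 - t != 0 by rewrite -[t]expr1 onem_neq0.
have x1 k : (1 - t) ^+ k != 0 by rewrite expf_neq0.
have h1 := qfact_neq0 (d - i); have h2 := qfact_neq0 (n.+1 - d - i).
have h3 := qfact2_neq0 i; have h4 : 1 - t ^+ n.+1 != 0 by apply: onem_neq0.
rewrite -(opprB 1 (t ^+ n.+1)).
move: (qfact _) (qfact _) h1 h2 => q1 q2 h1 h2.
move: (qfact2 _) (t_pochhammer _ _ _) h3 p_neq0 => q3 q4 h3 h5.
move: (1 - t ^+ n.+1) h4 => y h4.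
move: (x1 (2 * i)%N) (x1 (d - i)%N) (x1 (n.+1 - d - i)%N).
move: ((1 - t) ^+ _) ((1 - t) ^+ _) ((1 - t) ^+ _) => y1 y2 y3 h6 h7 h8.
by field; rewrite ?oppr_eq0 ?h1 ?h2 ?h3 ?h4 ?h5 ?h6 ?h7 ?h8.
Qed.

End Formula.

(** * Reduction to [b = 0] and conclusion *)

Lemma kostka_foulkes_omega_lt n a b : (a < b)%N -> (b <= n)%N ->
  kostka_foulkes (omega n a) (omega n b) = 0.
Proof.
elim: n a b => [|n IHn] [|a] [|b] // lt_ab le_bn; first exact: kostka_omega0S.
by rewrite kostka_omegaSS IHn.
Qed.

Lemma kostka_foulkes_omega_sub n a b : (b <= a)%N -> (b <= n)%N ->
  kostka_foulkes (omega n a) (omega n b) =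
  kostka_foulkes (omega (n - b) (a - b)) (omega (n - b) 0).
Proof.
elim: b n a => [|b IHb] [|n] [|a] //; rewrite ?subn0 // => le_ba le_bn.
by rewrite kostka_omegaSS IHb.
Qed.

Lemma kostka_omega_odd n d : (2 * d < n)%N ->
  kostka_foulkes (omega n (2 * d).+1) (omega n 0) = 0.
Proof.
elim: d n => [|d IHd] n; first by case: n => // n _; rewrite muln0 kostka_omega10.
(* Two inductions are nested: in the recurrence the terms with the smaller index fall to the one on
   [d], and the term with the same index in lower rank to the one on [n]. *)
elim/ltn_ind: n => -[|[|n]] // IHn.
have eq_d : (2 * d.+1).+1 = (2 * d).+1.+2 by lia.
move=> lt_dn; rewrite eq_d kostka_omega_rec; last by lia.
rewrite !IHd ?mulr0 ?addr0 ?subr0; try lia.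
by case: ifP => // lt_an; rewrite -eq_d IHn //; lia.
Qed.

Lemma tofrac_tvar_neq0 : tofrac tvar != 0.
Proof. by rewrite tofrac_eq0 polyC_eq0 polyX_eq0. Qed.

Lemma tofrac_tvarX_neq1 k : (0 < k)%N -> tofrac tvar ^+ k != 1.
Proof. by move=> k_gt0; rewrite -tofracXn -tofrac1 tofrac_eq tvarX_neq1. Qed.

(** The recurrence holds for both sides; it is compared in the fraction field, where the closed
    formula lives. *)
Lemma kostka_omega_even n d : (2 * d <= n)%N ->
  tofrac (kostka_foulkes (omega n (2 * d)) (omega n 0)) =
  kostka_formula (tofrac tvar) (tofrac uvar) n d.
Proof.
have t_neq0 := tofrac_tvar_neq0; have tX_neq1 := tofrac_tvarX_neq1.
elim: d n => [|d IHd] n.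
  by rewrite muln0 kostka_omega00 tofrac1 kostka_formula0.
elim/ltn_ind: n => -[|[|n]] // IHn; rewrite ?mulnS // => le_dn.
rewrite kostka_formula_rec //.
rewrite kostka_omega_rec; last by lia.
rewrite tofracB tofracD !tofracM tofracB tofracD tofracM !tofracXn !tofrac1.
rewrite !IHd; [|lia..]; congr (_ + _ - _).
case: ifP => [lt_dn|ge_dn]; first by rewrite -IHn ?mulnS //; lia.
by rewrite tofrac0 kostka_formula_vanish //; lia.
Qed.

Theorem theoremA (n a b : nat) (n_gt0 : (0 < n)%N)
    (a_le_n : (a <= n)%N) (b_le_n : (b <= n)%N) :
  (~ ((b <= a)%N /\ a = b %[mod 2]) ->
     kostka_foulkes (omega n a) (omega n b) = 0) /\
  ((b <= a)%N /\ a = b %[mod 2] ->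
     let t : {fraction Ztu} := tofrac tvar in
     let u : {fraction Ztu} := tofrac uvar in
     let d := ((a - b) %/ 2)%N in
     tofrac (kostka_foulkes (omega n a) (omega n b)) =
       t ^+ d * ((t ^+ (n + 1 - a) - 1) / (t ^+ (n + 1 - b) - 1)) *
       \sum_(0 <= i < d.+1)
          (- u) ^+ i *
          (t ^ ((i ^ 2)%N%:Z - (2 * i)%N%:Z) *
           t_multinomial t (n - b + 1) (2 * i) (d - i)
             (n + 1 - (a + b) %/ 2 - i) *
           t_pochhammer t (t ^+ 2) i)).
Proof.
have [lt_ab|le_ba] := ltnP a b.
  by split=> [_|[]]; first exact: kostka_foulkes_omega_lt.
rewrite kostka_foulkes_omega_sub //; split=> [odd_ab|[_ even_ab] t u d].
  have -> : (a - b = (2 * ((a - b) %/ 2)).+1)%N.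
    by have : a <> b %[mod 2] by [move=> e; apply: odd_ab]; lia.
  by apply: kostka_omega_odd; have : a <> b %[mod 2] by [move=> e; apply: odd_ab]; lia.
have eq_d : (a - b = 2 * d)%N by rewrite /d; lia.
have le_dn : (2 * d <= n - b)%N by lia.
rewrite eq_d kostka_omega_even //.
rewrite (kostka_formulaE _ tofrac_tvar_neq0 tofrac_tvarX_neq1) //.
(* The rank is now [n - b], and [a = b + 2 * d] gives [(a + b) %/ 2 = b + d]. *)
have -> : (n + 1 - a = (n - b).+1 - 2 * d)%N by lia.
have -> : (n + 1 - b = (n - b).+1)%N by lia.
have -> : (n + 1 - (a + b) %/ 2 = (n - b).+1 - d)%N by lia.
by rewrite addn1.
Qed.
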